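(* There is no infinite subsequence of the sequence $(\Gamma_n)_{n \geq 5}$ of Löbell reflection groups consisting entirely of pairwise commensurable lattices.
   Context: For $n \geq 5$, consider the combinatorial $3$-polyhedron with $2n+2$ faces whose ''top'' and ''bottom'' faces are $n$-gons and whose lateral surface consists of $2n$ pentagons: $n$ upper pentagons $U_i$ and $n$ lower pentagons $V_i$ ($i \in \mathbb{Z}/n$), where $U_i$ is adjacent to the top face, $U_{i\pm 1}$, $V_i$ and $V_{i+1}$, and $V_i$ is adjacent to the bottom face, $V_{i\pm1}$, $U_{i-1}$ and $U_i$. By Andreev's theorem it is realized, uniquely up to isometry, as a compact polyhedron $L_n \subset \mathbb{H}^3$ all of whose dihedral angles are $\pi/2$; this is the Löbell polyhedron $L_n$. Let $\Gamma_n < \mathrm{Isom}(\mathbb{H}^3)$ be the group generated by the reflections in the faces of $L_n$; it is a cocompact lattice. Two lattices $\Gamma, \Gamma' < \mathrm{Isom}(\mathbb{H}^3)$ are commensurable if $\Gamma$ and some conjugate of $\Gamma'$ in $\mathrm{Isom}(\mathbb{H}^3)$ have intersection of finite index in both. *)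

(* Defs.v *)
From HB Require Import structures.
From mathcomp Require Import all_boot all_order all_algebra all_fingroup.
From mathcomp Require Import all_classical all_reals all_analysis.
From mathcomp Require Import ring lra.
Set Implicit Arguments.
Unset Strict Implicit.
Unset Printing Implicit Defensive.

Import Order.TTheory GRing.Theory Num.Theory.
Import numFieldNormedType.Exports.

Local Open Scope classical_set_scope.
Local Open Scope ring_scope.

Section Commensurability.
Variable G : groupType.
Local Open Scope group_scope.

Definition is_subgroup (H : set G) : Prop :=
  [/\ H 1, forall x y, H x -> H y -> H (x * y) & forall x, H x -> H x^-1].

Definition generated_subgroup (S : set G) : set G := smallest is_subgroup S.

Definition left_coset (x : G) (K : set G) : set G := [set x * k | k in K].

(* Meant for subgroups K `<=` H: K has finitely many left cosets in H. *)
Definition finite_index (H K : set G) : Prop :=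
  finite_set [set left_coset x K | x in H].

Definition conjugate (g : G) (H : set G) : set G := [set g * h * g^-1 | h in H].

Definition commensurable (H H' : set G) : Prop :=
  exists g : G, finite_index H (H `&` conjugate g H') /\
                finite_index (conjugate g H') (H `&` conjugate g H').

End Commensurability.

Section HyperbolicSpace.
Variable R : realType.

Definition minkowski (x y : 'rV[R]_4) : R :=
  - (x 0 0 * y 0 0) + \sum_(i < 3) x 0 (lift ord0 i) * y 0 (lift ord0 i).

(* Hyperboloid model: the upper sheet of <x, x> = -1 in R^{1,3}. *)
Record hpoint := HPoint {
  hval :> 'rV[R]_4;
  _ : (minkowski hval hval == -1) && (0 < hval 0 0) }.

HB.instance Definition _ := [isSub for hval].
HB.instance Definition _ := [Choice of hpoint by <:].

Definition arcosh (c : R) : R := ln (c + Num.sqrt (c ^+ 2 - 1)).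

Definition hdist (x y : hpoint) : R := arcosh (- minkowski x y).

Record hisometry := HIsometry {
  hiso_fun :> hpoint -> hpoint;
  hiso_inv : hpoint -> hpoint;
  _ : cancel hiso_fun hiso_inv;
  _ : cancel hiso_inv hiso_fun;
  _ : forall x y, hdist (hiso_fun x) (hiso_fun y) = hdist x y }.

Lemma hiso_funK (g : hisometry) : cancel g (hiso_inv g).
Proof. by case: g. Qed.

Lemma hiso_invK (g : hisometry) : cancel (hiso_inv g) g.
Proof. by case: g. Qed.

Lemma hiso_dist (g : hisometry) x y : hdist (g x) (g y) = hdist x y.
Proof. by case: g x y. Qed.

Lemma hisometryP (g h : hisometry) : hiso_fun g =1 hiso_fun h -> g = h.
Proof.
case: g h => [f f' fK f'K fd] [k k' kK k'K kd] /= fk.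
have {}fk : f = k by apply/funext.
subst k; have f'k' : f' = k' by apply/funext => x; rewrite -{1}(k'K x) fK.
subst k'; congr HIsometry; exact: Prop_irrelevance.
Qed.

Definition hiso_one : hisometry :=
  @HIsometry id id (fun=> erefl) (fun=> erefl) (fun _ _ => erefl).

Definition hiso_opp (g : hisometry) : hisometry.
Proof.
refine (@HIsometry (hiso_inv g) g (@hiso_invK g) (@hiso_funK g) _).
by move=> x y; rewrite -(hiso_dist g) !hiso_invK.
Defined.

(* (g * h) x = g (h x) *)
Definition hiso_mul (g h : hisometry) : hisometry.
Proof.
refine (@HIsometry (g \o h) (hiso_inv h \o hiso_inv g) _ _ _).
- by move=> x /=; rewrite !hiso_funK.
- by move=> x /=; rewrite !hiso_invK.
- by move=> x y /=; rewrite !hiso_dist.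
Defined.

HB.instance Definition _ := gen_eqMixin hisometry.
HB.instance Definition _ := gen_choiceMixin hisometry.

Lemma hiso_mulA : associative hiso_mul.
Proof. by move=> f g h; apply: hisometryP. Qed.
Lemma hiso_mul1g : left_id hiso_one hiso_mul.
Proof. by move=> f; apply: hisometryP. Qed.
Lemma hiso_mulg1 : right_id hiso_one hiso_mul.
Proof. by move=> f; apply: hisometryP. Qed.
Lemma hiso_mulVg : left_inverse hiso_one hiso_opp hiso_mul.
Proof. by move=> f; apply: hisometryP => x /=; rewrite hiso_funK. Qed.
Lemma hiso_mulgV : right_inverse hiso_one hiso_opp hiso_mul.
Proof. by move=> f; apply: hisometryP => x /=; rewrite hiso_invK. Qed.

HB.instance Definition _ := isGroup.Build hisometry
  hiso_mulA hiso_mul1g hiso_mulg1 hiso_mulVg hiso_mulgV.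

(* g is the reflection in the hyperplane <x, e> = 0, for e with <e, e> = 1. *)
Definition is_reflection (e : 'rV[R]_4) (g : hisometry) : Prop :=
  forall x : hpoint, hval (g x) = hval x - (2 * minkowski x e) *: e.

Lemma is_reflection_exists (e : 'rV[R]_4) :
  minkowski e e = 1 -> exists g, is_reflection e g.
Proof.
move=> e1; pose r (x : 'rV[R]_4) := x - (2 * minkowski x e) *: e.
have mE (x y : 'rV[R]_4) : minkowski x y =
    - (x 0 0 * y 0 0) + (x 0 1 * y 0 1 + x 0 2 * y 0 2 + x 0 3 * y 0 3).
  rewrite /minkowski !big_ord_recr big_ord0 /= add0r.
  by congr (- _ + (_ + _ + _)); congr (x 0 _ * y 0 _); apply: val_inj.
have rr (x y : 'rV[R]_4) : minkowski (r x) (r y) = minkowski x y.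
  have -> : minkowski (r x) (r y) = minkowski x y
      + 4 * minkowski x e * minkowski y e * (minkowski e e - 1).
    by rewrite /r !mE !mxE; ring.
  by rewrite e1 subrr mulr0 addr0.
have rK : involutive r.
  move=> x; have re : minkowski (r x) e = - minkowski x e.
    have -> : minkowski (r x) e = minkowski x e * (1 - 2 * minkowski e e).
      by rewrite /r !mE !mxE; ring.
    by rewrite e1; ring.
  by rewrite {1}/r re mulrN scaleNr opprK subrK.
have cs (a1 a2 a3 b1 b2 b3 : R) : (a1 * b1 + a2 * b2 + a3 * b3) ^+ 2 <=
    (a1 ^+ 2 + a2 ^+ 2 + a3 ^+ 2) * (b1 ^+ 2 + b2 ^+ 2 + b3 ^+ 2).
  rewrite -subr_ge0.
  have -> : (a1 ^+ 2 + a2 ^+ 2 + a3 ^+ 2) * (b1 ^+ 2 + b2 ^+ 2 + b3 ^+ 2)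
      - (a1 * b1 + a2 * b2 + a3 * b3) ^+ 2 = (a1 * b2 - a2 * b1) ^+ 2
      + (a1 * b3 - a3 * b1) ^+ 2 + (a2 * b3 - a3 * b2) ^+ 2 by ring.
  by rewrite !addr_ge0 ?sqr_ge0.
have rh (x : hpoint) : (minkowski (r x) (r x) == -1) && (0 < r x 0 0).
  case: x => x /= /andP[/eqP x1 x0]; rewrite rr x1 eqxx /= ltNge.
  apply/negP => y0; have y1 : minkowski (r x) (r x) = -1 by rewrite rr.
  have xy : minkowski x (r x) <= -1.
    have -> : minkowski x (r x) = minkowski x x - 2 * minkowski x e ^+ 2.
      by rewrite /r !mE !mxE; ring.
    by rewrite x1; have := sqr_ge0 (minkowski x e); lra.
  move: (r x) y0 y1 xy x1 => y; rewrite !mE => y0 y1 xy x1.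
  have {}cs := cs (x 0 1) (x 0 2) (x 0 3) (y 0 1) (y 0 2) (y 0 3).
  move: cs xy.
  have -> : x 0 1 ^+ 2 + x 0 2 ^+ 2 + x 0 3 ^+ 2 = x 0 0 ^+ 2 - 1 by lra.
  have -> : y 0 1 ^+ 2 + y 0 2 ^+ 2 + y 0 3 ^+ 2 = y 0 0 ^+ 2 - 1 by lra.
  set s := _ + _ * y 0 3 => cs xy.
  have xx1 : 1 <= x 0 0 ^+ 2.
    by have := sqr_ge0 (x 0 1); have := sqr_ge0 (x 0 2);
       have := sqr_ge0 (x 0 3); lra.
  have yy1 : 1 <= y 0 0 ^+ 2.
    by have := sqr_ge0 (y 0 1); have := sqr_ge0 (y 0 2);
       have := sqr_ge0 (y 0 3); lra.
  have xy0 : x 0 0 * y 0 0 <= 0 by rewrite pmulr_rle0.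
  nra.
pose f (x : hpoint) := HPoint (rh x).
have fK : involutive f by move=> x; apply: val_inj; exact: rK.
have fd x y : hdist (f x) (f y) = hdist x y by rewrite /hdist /= rr.
by exists (HIsometry fK fK fd).
Qed.

Section Polyhedra.
Variables (F : finType) (e : F -> 'rV[R]_4).

(* The intersection of the half-spaces with outward unit normals [e a]. *)
Definition hpolyhedron : set hpoint :=
  [set x | forall a, minkowski x (e a) <= 0].

Definition hface (a : F) : set hpoint :=
  hpolyhedron `&` [set x | minkowski x (e a) = 0].

(* [hpolyhedron] is three-dimensional, and F indexes its two-dimensional faces
   without repetition: each [hface a] has a point off all other hyperplanes. *)
Definition is_hpolyhedron : Prop :=
  [/\ forall a, minkowski (e a) (e a) = 1,
      exists x : hpoint, forall a, minkowski x (e a) < 0 &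
      forall a, exists2 x : hpoint, minkowski x (e a) = 0 &
        forall b, b != a -> minkowski x (e b) < 0].

(* The topology of the hyperboloid is the one induced from R^4. *)
Definition hcompact (A : set hpoint) : Prop := compact (hval @` A).

(* Two faces have a common edge: their intersection is not just a vertex. *)
Definition share_edge (a b : F) : Prop :=
  exists x y : hpoint,
    [/\ x <> y, (hface a `&` hface b) x & (hface a `&` hface b) y].

(* The angle at a common edge, measured inside the polyhedron. *)
Definition dihedral_angle (a b : F) : R := acos (- minkowski (e a) (e b)).

Definition reflection_group : set hisometry :=
  generated_subgroup [set g | exists a, is_reflection (e a) g].

End Polyhedra.

End HyperbolicSpace.

Arguments hcompact {R} A.

(* Indices are taken in 'Z_n, which is Z/n for n >= 2. *)
Inductive lobell_face (n : nat) : Type :=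
  | Top | Bottom | Upper of 'Z_n | Lower of 'Z_n.

Arguments Top {n}.
Arguments Bottom {n}.

Section LobellFaceFinite.
Variable n : nat.

Definition lobell_face_code (a : lobell_face n) : bool * option 'Z_n :=
  match a with
  | Top => (true, None)
  | Bottom => (false, None)
  | Upper i => (true, Some i)
  | Lower i => (false, Some i)
  end.

Definition lobell_face_decode (c : bool * option 'Z_n) : lobell_face n :=
  match c with
  | (true, None) => Top
  | (false, None) => Bottom
  | (true, Some i) => Upper i
  | (false, Some i) => Lower i
  end.

Lemma lobell_face_codeK : cancel lobell_face_code lobell_face_decode.
Proof. by case. Qed.

HB.instance Definition _ :=
  Finite.copy (lobell_face n) (can_type lobell_face_codeK).

Definition lobell_adjacent (a b : lobell_face n) : bool :=
  match a, b with
  | Top, Upper _ | Upper _, Top | Bottom, Lower _ | Lower _, Bottom => true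
  | Upper i, Upper j | Lower i, Lower j => (j == i + 1) || (j == i - 1)
  | Upper i, Lower j | Lower j, Upper i => (j == i) || (j == i + 1)
  | _, _ => false
  end.

End LobellFaceFinite.

(* A compact right-angled polyhedron of the Loebell combinatorial type. Right
   angles make the polyhedron simple, so that its combinatorial type is
   determined by which pairs of faces are adjacent. *)
Definition is_lobell (R : realType) (n : nat)
    (e : lobell_face n -> 'rV[R]_4) : Prop :=
  [/\ is_hpolyhedron e, hcompact (hpolyhedron e),
      forall a b, a != b -> (share_edge e a b <-> lobell_adjacent a b) &
      forall a b, a != b -> share_edge e a b -> dihedral_angle e a b = pi / 2].

(* Main.v *)
From HB Require Import structures.
Require Import Defs.
From mathcomp Require Import all_boot all_order all_algebra all_fingroup all_field.
From mathcomp Require Import all_classical all_reals all_analysis.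
From mathcomp Require Import complex.
From mathcomp Require Import zify ring lra.
(* Importing the definitions again makes [minkowski] the bilinear form rather
   than the Minkowski inequality of measure theory. *)
Require Import Defs.
Set Implicit Arguments.
Unset Strict Implicit.
Unset Printing Implicit Defensive.
Import Order.TTheory GRing.Theory Num.Theory.
Import numFieldNormedType.Exports.
Local Open Scope ring_scope.

(** The proof attaches to the n-th Loebell polyhedron a real number m with
    m - 1 = zeta + 1/zeta for a primitive n-th root of unity zeta, and shows
    that m^2 lies in the field generated by the Gram matrix of any polyhedron
    whose reflection group is commensurable with the n-th Loebell group.  If
    infinitely many Loebell groups were pairwise commensurable, compare all of
    them with the first one: its Gram matrix generates a fixed number field,
    say of degree D, so infinitely many n would satisfy
    totient n <= 4 * D, whereas n <= (2 * totient n)! for all positive n.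

    Rigidity.  Listed in zigzag order, the 2n lateral faces w_j are such that
    w_j is orthogonal to w_{j+1} and w_{j+2}; one cap is orthogonal to all the
    even ones, the other to all the odd ones.  Every lateral face is a
    right-angled pentagon, and the identity cosh = sinh sinh for its sides
    ([right_angled_chain]) relates the quantities S_j = sinh^2 of the edges
    between two faces of the same ring to the quantities Z_j = sinh^2 of the
    zigzag edges.  Eliminating Z_j gives
      (S_j + 1) S_{j+1} = (S_{j+3} + 1) S_{j+2},
    and a maximum principle for the ratios S_{j+1} / S_j
    ([positive_recurrence_const]) forces the cyclic sequence S to be constant.
    Hence Z_j is constant too; its value is m ([lobell_modulus]), and
    w_{j+4} = w_j + a w_{j+3} - a w_{j+1} with a^2 = m + 1 ([lateral_rec]).
    Consequently every entry of the Gram matrix is algebraic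
    ([lobell_gram_algebraic]).  The differences of consecutive upper normals
    satisfy y_{i+2} = (m - 1) y_{i+1} - y_i with exact period n, so that the
    roots of X^2 - (m - 1) X + 1 are primitive n-th roots of unity
    ([lobell_cheb], [lobell_cheb_order], [cheb_primitive_root]).

    Commensurability.  Isometries are Lorentz matrices ([hisometry_linear]),
    and the matrices of a reflection group are combinations of the identity
    and of the rank-one matrices built from pairs of normals, with
    coefficients in the ring of the Gram entries
    ([reflection_group_gram_form]); hence so are their traces.  The product of
    the reflections in two ultraparallel faces is a translation, and the
    orthogonal projector onto the fixed plane of that translation is a
    polynomial in any of its positive powers, with coefficients in the trace
    field ([translation_power]).  Some positive power lies in the conjugate of
    the other group, so the trace of the product of two such projectors is in
    the Gram field of that other group.  For two well-chosen translations this
    trace is 1 + m^2 ([commensurable_modulus]). *)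

(** * Degrees of roots of unity *)

(** Each prime power p^e exactly dividing n satisfies p^e <= 2 * totient (p^e),
    hence divides the factorial on the right, and so does n. *)
Lemma leq_fact_totient n : (0 < n)%N -> (n <= ((totient n).*2)`!)%N.
Proof.
move=> n_gt0; apply: dvdn_leq; first exact: fact_gt0.
apply/(dvdn_partP _ n_gt0) => p /[!mem_primes] /and3P[p_pr _ p_dv].
have e_gt0 : (0 < logn p n)%N by rewrite logn_gt0 mem_primes p_pr n_gt0.
apply: dvdn_fact; rewrite part_gt0 /=.
have {2}-> : n = (n`_p * n`_p^')%N by rewrite partnC.
rewrite totient_coprime ?coprime_partC // p_part totient_pfactor //.
have := totient_gt0 (n`_p^'); rewrite part_gt0.
move: (totient n`_p^') => m m_gt0; rewrite doubleMl.
apply: leq_trans (leq_pmulr _ m_gt0).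
rewrite -{1}(prednK e_gt0) expnS doubleMl leq_mul2r.
apply/orP; right; rewrite -addnn.
by case: p p_pr {p_dv e_gt0} => [|[|p]] // _; rewrite addnS ltnS leq_addr.
Qed.

(** The cyclotomic polynomial is irreducible over the rationals, also when its
    roots are taken in another field of characteristic zero. *)
Lemma totient_lt_size (F : numFieldType) n (z : F) (h : {poly rat}) :
  n.-primitive_root z -> h != 0 -> root (map_poly ratr h) z ->
  (totient n < size h)%N.
Proof.
move=> prim_z h_neq0 hz; have n_gt0 := prim_order_gt0 prim_z.
have [w prim_w] := C_prim_root_exists n_gt0.
have [p [Dp mon_p] min_p] := minCpolyP w.
have Dphi : map_poly ratr p = map_poly intr 'Phi_n :> {poly algC}.
  by rewrite -Dp (minCpoly_cyclotomic prim_w) (Cintr_Cyclotomic prim_w).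
have {}Dphi : p = map_poly intr 'Phi_n.
  apply: (map_inj_poly (fmorph_inj (ratr : {rmorphism rat -> algC}))).
    exact: rmorph0.
  apply: etrans Dphi _; rewrite -map_poly_comp; apply: eq_map_poly => a.
  by rewrite /= rmorph_int.
have pz : root (map_poly ratr p) z.
  have : root (map_poly intr ('X^n - 1 : {poly int}) : {poly F}) z.
    by rewrite rmorphB rmorph1 /= map_polyXn rootE !hornerE prim_expr_order ?subrr.
  rewrite -prod_Cyclotomic // rmorph_prod /= rootE horner_prod prodf_seq_eq0.
  case/hasP => d; rewrite -dvdn_divisors // => d_dv_n /= dz.
  have d_gt0 := dvdn_gt0 n_gt0 d_dv_n.
  have : z ^+ d == 1.
    rewrite -subr_eq0; apply/eqP.
    have -> : z ^+ d - 1 = (map_poly intr ('X^d - 1 : {poly int})).[z].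
      by rewrite rmorphB rmorph1 /= map_polyXn !hornerE.
    rewrite -prod_Cyclotomic // rmorph_prod /= horner_prod.
    apply/eqP; rewrite prodf_seq_eq0; apply/hasP; exists d => //.
    by rewrite -dvdn_divisors.
  rewrite -(prim_order_dvd prim_z) => n_dv_d.
  have Ed : d = n by apply/eqP; rewrite eqn_dvd d_dv_n.
  rewrite Dphi -map_poly_comp rootE -Ed.
  by rewrite (eq_map_poly (g := intr)) // => a /=; rewrite rmorph_int.
(* p and h share the root z in F: a Bezout relation over the rationals would
   evaluate to 0 = 1 there.  So they share a root among algebraic numbers. *)
have ncop : ~~ coprimep p h.
  apply/negP => /Bezout_eq1_coprimepP[[u v] /= uv].
  have := congr1 (fun q => (map_poly ratr q).[z] : F) uv.
  rewrite rmorphD !rmorphM /= rmorph1 !hornerE (rootP pz) (rootP hz).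
  by rewrite !mulr0 addr0 => /esym/eqP; rewrite oner_eq0.
have [x xg] : exists x, root (map_poly ratr (gcdp p h) : {poly algC}) x.
  by apply/closed_rootP; rewrite size_map_poly.
have xp : root (map_poly ratr p) x.
  by move: xg; apply/root_dvdp; rewrite dvdp_map dvdp_gcdl.
have xh : root (map_poly ratr h) x.
  by move: xg; apply/root_dvdp; rewrite dvdp_map dvdp_gcdr.
have prim_x : n.-primitive_root x.
  by rewrite -(root_cyclotomic prim_w) -minCpoly_cyclotomic // Dp.
have [q [Dq _] min_q] := minCpolyP x.
move: xh; rewrite min_q => q_dv_h.
rewrite -(size_cyclotomic x n) -minCpoly_cyclotomic // Dq size_map_poly.
exact: dvdp_leq.
Qed.


Local Notation ratrp := (map_poly ratr).

(** The ring Q[z]; it is a field as soon as z is algebraic. *)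
Definition rat_adjoin (F : unitRingType) (z x : F) := exists q, x = (ratrp q).[z].

Section Adjoin.
Variables (F : numFieldType) (z : F).
Implicit Types x y : F.

Lemma rat_adjoin_rat a : rat_adjoin z (ratr a).
Proof. by exists a%:P; rewrite map_polyC hornerC. Qed.

Lemma rat_adjoinD x y : rat_adjoin z x -> rat_adjoin z y -> rat_adjoin z (x + y).
Proof.
by move=> [p ->] [q ->]; exists (p + q); rewrite rmorphD hornerD.
Qed.

Lemma rat_adjoinN x : rat_adjoin z x -> rat_adjoin z (- x).
Proof. by move=> [p ->]; exists (- p); rewrite rmorphN hornerN. Qed.

Lemma rat_adjoinM x y : rat_adjoin z x -> rat_adjoin z y -> rat_adjoin z (x * y).
Proof.
by move=> [p ->] [q ->]; exists (p * q); rewrite rmorphM hornerM.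
Qed.

(** The powers 1, x, ..., x^D are D + 1 elements of a rational vector space of
    dimension at most D, where D is the degree of p. *)
Lemma rat_adjoin_degree (p : {poly rat}) x : p != 0 -> root (ratrp p) z -> rat_adjoin z x ->
  exists g : {poly rat}, [/\ g != 0, (size g <= size p)%N & root (ratrp g) x].
Proof.
move=> p_neq0 pz [q ->].
have sp : (0 < size p)%N by rewrite size_poly_gt0.
pose D := (size p).-1.
pose A := \matrix_(i < D.+1, j < D) ((q ^+ i) %% p)`_j.
(* Row i of A holds the coordinates of x^i in the powers of z. *)
have : kermx A != 0.
  rewrite -mxrank_eq0 mxrank_ker subn_eq0 -ltnNge ltnS.
  exact: rank_leq_col.
case/rowV0Pn => v /sub_kermxP vA v_neq0.
exists (rVpoly v); split.
- by apply: contra v_neq0 => /eqP g0; rewrite -(rVpolyK v) g0 linear0.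
- by rewrite (leq_trans (size_poly _ _)) // prednK.
have : p %| \sum_(i < D.+1) v 0 i *: q ^+ i.
  apply/modp_eq0P; rewrite -[LHS]/(modp _ _).
  have -> : (\sum_(i < D.+1) v 0 i *: q ^+ i) %% p
          = \sum_(i < D.+1) v 0 i *: ((q ^+ i) %% p).
    elim/big_rec2: _ => [|i y1 y2 _ IH]; first by rewrite mod0p.
    by rewrite modpD modpZl IH.
  apply/polyP => j; rewrite coef_sum coef0.
  have [jD|Dj] := ltnP j D.
    have /matrixP/(_ 0 (Ordinal jD)) := vA.
    rewrite !mxE => E; rewrite -[RHS]E; apply: eq_bigr => i _.
    by rewrite coefZ !mxE.
  apply: big1 => i _; rewrite coefZ nth_default ?mulr0 //.
  by rewrite -ltnS (leq_trans (ltn_modpN0 _ p_neq0)) // -(prednK sp) ltnS.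
case/dvdpP => u Du.
have := congr1 (fun r => (ratrp r).[z] : F) Du.
rewrite rmorphM hornerM (rootP pz) mulr0 rmorph_sum horner_sum => Es.
apply/eqP; rewrite -[RHS]Es.
rewrite (@horner_coef_wide _ D.+1); last by rewrite size_map_poly size_poly.
apply: eq_bigr => i _; rewrite coef_map coef_rVpoly_ord.
by rewrite [RHS](_ : _ = (ratrp (v 0 i *: q ^+ i)).[z]) // map_polyZ hornerZ rmorphXn horner_exp.
Qed.

(** Cancelling the powers of X in an equation for x leaves a nonzero constant
    term, by which x^-1 is expressed as a polynomial in x. *)
Lemma rat_adjoinV (p : {poly rat}) x : p != 0 -> root (ratrp p) z -> rat_adjoin z x ->
  rat_adjoin z x^-1.
Proof.
have [->|x_neq0] := eqVneq x 0; first by rewrite invr0.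
move=> p_neq0 pz xV; have [g [g_neq0 _ gx]] := rat_adjoin_degree p_neq0 pz xV.
have [m [r r0 Dg]] := multiplicity_XsubC g 0.
rewrite g_neq0 /= rootE in r0.
have rx : (ratrp r).[x] = 0.
  move: gx; rewrite Dg rmorphM rmorphXn rmorphB /= map_polyX map_polyC /=.
  rewrite rmorph0 subr0 rootE hornerM hornerXn mulf_eq0 expf_eq0 (negPf x_neq0).
  by rewrite andbF orbF => /eqP.
have Dr : r = r.[0]%:P + 'X * (drop_poly 1 r).
  rewrite -[LHS](poly_take_drop 1) mulrC expr1; congr (_ + _).
  apply/polyP => i; rewrite coef_take_poly coefC horner_coef0.
  by case: i.
have inv : x^-1 = - (ratr r.[0])^-1 * (ratrp (drop_poly 1 r)).[x].
  move: rx; rewrite {1}Dr rmorphD rmorphM /= map_polyC map_polyX /=.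
  rewrite !hornerE => rx.
  have c0 : (ratr r.[0] : F) != 0 by rewrite fmorph_eq0.
  move: rx; set c := ratr _ in c0 *; set d := _.[x] => rx.
  apply: (mulfI x_neq0); rewrite mulfV //.
  rewrite mulrCA mulNr; have -> : x * d = - c by apply/eqP; rewrite -addr_eq0 addrC rx.
  by rewrite mulrN opprK mulVf.
rewrite inv -fmorphV -rmorphN; apply: rat_adjoinM; first exact: rat_adjoin_rat.
case: xV => q ->; exists (drop_poly 1 r \Po q).
by rewrite map_comp_poly horner_comp.
Qed.

End Adjoin.

Lemma algebraic_primitive_element (F : numFieldType) (s : seq F) :
  (forall x, x \in s -> algebraicOver ratr x) ->
  exists2 z : F, algebraicOver ratr z & forall x, x \in s -> rat_adjoin z x.
Proof.
elim: s => [|x s IHs] salg.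
  by exists 0 => //; exact: algebraic0.
have [y|z [p p_neq0 pz] zs] := IHs; first by move=> ys; apply: salg; rewrite inE ys orbT.
have [q q_neq0 qx] := salg x (mem_head _ _).
have [n [[u Du] [v Dv]]] :=
  pchar0_PET p_neq0 pz q_neq0 qx (pchar_num _).
exists (x *+ n - z).
  apply: (@algebraic_sub _ _ (ratr : {rmorphism rat -> F})); last by exists p.
  rewrite -mulr_natr; apply: (@algebraic_mul _ _ (ratr : {rmorphism rat -> F})).
    by exists q.
  rewrite -(ratr_nat F).
  exact: (@algebraic_id _ _ (ratr : {rmorphism rat -> F})).
move=> y; rewrite inE => /predU1P[->|/zs[r ->]]; first by exists v.
by exists (r \Po u); rewrite map_comp_poly horner_comp Du.
Qed.

(** * Chebyshev polynomials and roots of unity *)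

(** The Chebyshev polynomial of the second kind U_{k-1}, evaluated at t/2; it
    solves the recurrence y_{i+2} = t y_{i+1} - y_i. *)
Fixpoint cheb {A : pzRingType} (t : A) (k : nat) : A :=
  match k with
  | 0 => 0
  | 1 => 1
  | (k'.+1 as k1).+1 => t * cheb t k1 - cheb t k'
  end.

Arguments cheb {A} t k : simpl nomatch.

Lemma chebSS (A : pzRingType) (t : A) k :
  cheb t k.+2 = t * cheb t k.+1 - cheb t k.
Proof. by []. Qed.

Lemma rmorph_cheb (A B : pzRingType) (f : {rmorphism A -> B}) t k :
  f (cheb t k) = cheb (f t) k.
Proof.
suff [] : f (cheb t k) = cheb (f t) k /\ f (cheb t k.+1) = cheb (f t) k.+1 by [].
elim: k => [|k [IH1 IH2]]; first by rewrite /= rmorph0 rmorph1.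
by rewrite !chebSS rmorphB rmorphM IH1 IH2.
Qed.

Lemma size_chebX k : size (cheb ('X : {poly rat}) k) = k.
Proof.
suff [] : size (cheb ('X : {poly rat}) k) = k
  /\ size (cheb ('X : {poly rat}) k.+1) = k.+1 by [].
elim: k => [|k [IH1 IH2]]; first by rewrite /= size_poly0 size_poly1.
split=> //; rewrite chebSS size_polyDl ?size_polyN ?IH1 mulrC size_mulX ?IH2 //.
  by rewrite -size_poly_eq0 IH2.
by rewrite -size_poly_eq0 IH2.
Qed.

Lemma cheb_root_algebraic (F : numFieldType) (t : F) k :
  cheb t k.+1 = 0 -> algebraicOver ratr t.
Proof.
move=> t0; exists (cheb ('X : {poly rat}) k.+1).
  by rewrite -size_poly_eq0 size_chebX.
rewrite rootE (rmorph_cheb (map_poly ratr)) /= map_polyX.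
by rewrite -[X in X == _]/(horner_eval t _) rmorph_cheb /= horner_evalE hornerX t0.
Qed.

Lemma cheb_exp (F : fieldType) (z : F) k : z != 0 ->
  cheb (z + z^-1) k * (z - z^-1) = z ^+ k - z^-1 ^+ k.
Proof.
move=> z0.
suff [] : cheb (z + z^-1) k * (z - z^-1) = z ^+ k - z^-1 ^+ k
  /\ cheb (z + z^-1) k.+1 * (z - z^-1) = z ^+ k.+1 - z^-1 ^+ k.+1 by [].
elim: k => [|k [IH1 IH2]]; first by rewrite /= mul0r mul1r !expr0 subrr !expr1.
split=> //; rewrite chebSS mulrBl -mulrA IH1 IH2 !exprS.
by field.
Qed.

(** The degenerate case z = z^-1 of [cheb_exp], where t = 2 or t = -2. *)
Lemma cheb_double (F : fieldType) (z : F) k : z * z = 1 ->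
  cheb (z + z) k.+1 = z ^+ k *+ k.+1.
Proof.
move=> z1.
suff [] : cheb (z + z) k.+1 = z ^+ k *+ k.+1
  /\ cheb (z + z) k.+2 = z ^+ k.+1 *+ k.+2 by [].
elim: k => [|k [IH1 IH2]]; first by rewrite chebSS /= mulr1 subr0 expr0 expr1.
split=> //; rewrite chebSS IH1 IH2.
rewrite -[X in _ * X - _]mulr_natr -[X in _ - X]mulr_natr -[RHS]mulr_natr.
rewrite !exprSr -!mulrA.
have -> : (z + z) * (z ^+ k * (z * k.+2%:R)) = z ^+ k * ((z * z) * (2 * k.+2%:R)) by ring.
have -> : z ^+ k * (z * (z * k.+3%:R)) = z ^+ k * ((z * z) * k.+3%:R) by ring.
rewrite z1 -!natr1; ring.
Qed.

(** The hypotheses say that the recurrence with parameter t has period exactly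
    n + 1: the powers of a root of X^2 - t X + 1 are then periodic with the same
    exact period.  The root cannot be 1 or -1, since [cheb] never vanishes at a
    positive index in these degenerate cases. *)
Lemma cheb_primitive_root (R : rcfType) (t : R) n :
  cheb t n.+1 = 0 -> cheb t n = -1 ->
  (forall d, cheb t d = 0 -> cheb t d.+1 = 1 -> (n.+1 %| d)%N) ->
  exists2 z : R[i], n.+1.-primitive_root z & z + z^-1 = t%:C%C.
Proof.
move=> tn tn1 min.
have [z] : exists z : R[i], root ('X^2 - t%:C%C *: 'X + 1) z.
  apply/closed_rootP.
  rewrite -addrA size_polyDl size_polyXn //.
  apply: leq_ltn_trans (size_polyD _ _) _; rewrite gtn_max size_polyN size_poly1.
  by rewrite (leq_ltn_trans (size_scale_leq _ _)) // size_polyX.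
rewrite rootE !hornerE => /eqP Ez.
have z0 : z != 0.
  apply/eqP => z0; move: Ez; rewrite z0 expr0n mulr0 subr0 add0r => /eqP.
  by rewrite oner_eq0.
have Dt : z + z^-1 = t%:C%C.
  apply: (mulfI z0); rewrite mulrDr mulfV //.
  by apply/eqP; rewrite -subr_eq0 -Ez; apply/eqP; ring.
have chC k : cheb (z + z^-1) k = (cheb t k)%:C%C.
  by rewrite Dt; apply/esym; exact: (rmorph_cheb (real_complex R)).
have zz : z - z^-1 != 0.
  apply/eqP => /eqP; rewrite subr_eq0 => /eqP zV.
  have z1 : z * z = 1 by rewrite {2}zV mulfV.
  have := chC n.+1; rewrite tn -zV cheb_double // => /eqP.
  by rewrite -mulr_natr mulf_eq0 expf_eq0 (negPf z0) andbF pnatr_eq0.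
(* The real recurrence inherits any period of the powers of z. *)
have powE d : z ^+ d = 1 -> (n.+1 %| d)%N.
  move=> zd; apply: min; apply: (fmorph_inj (real_complex R)).
    apply: (mulIf zz); rewrite /= -chC cheb_exp // exprVn zd invr1 subrr.
    by rewrite mul0r.
  apply: (mulIf zz); rewrite /= -chC cheb_exp // exprVn exprSr zd !mul1r.
  by [].
have zn : z ^+ n.+1 = 1.
  have E0 := cheb_exp n.+1 z0; rewrite chC tn mul0r in E0.
  have E1 := cheb_exp n z0; rewrite chC tn1 rmorphN1 mulN1r in E1.
  have Vn : z^-1 ^+ n.+1 = z ^+ n.+1 by apply/esym/eqP; rewrite -subr_eq0 -E0.
  have En : z ^+ n = z ^+ n.+1 * z^-1 by rewrite exprSr mulfK.
  have EVn : z^-1 ^+ n = z ^+ n.+1 * z by rewrite -Vn exprSr mulfVK.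
  apply: (mulIf zz); rewrite mul1r mulrBr -En -EVn.
  by rewrite -[RHS]opprK E1 opprB.
have [m prim_m m_dv] := prim_order_exists (ltn0Sn n) zn.
have -> : n.+1 = m.
  by apply/eqP; rewrite eqn_dvd m_dv powE // prim_expr_order.
by exists z.
Qed.

(** As (t + 1)^2 = ((z^2 + z + 1) / z)^2, an equation of degree D for the left
    side becomes, after multiplication by z^(2 D), one of degree 4 D for z. *)
Lemma totient_le_cheb_degree (R : rcfType) (t : R) n (g : {poly rat}) :
  cheb t n.+1 = 0 -> cheb t n = -1 ->
  (forall d, cheb t d = 0 -> cheb t d.+1 = 1 -> (n.+1 %| d)%N) ->
  g != 0 -> root (ratrp g) ((t + 1) ^+ 2) ->
  (totient n.+1 <= 4 * (size g).-1)%N.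
Proof.
move=> tn tn1 min g_neq0 gt.
have [z prim_z Dt] := cheb_primitive_root tn tn1 min.
have z0 : z != 0 by rewrite (prim_root_eq0 prim_z).
pose D := (size g).-1.
have Dg : size g = D.+1 by rewrite prednK // size_poly_gt0.
pose h := \sum_(k < D.+1) g`_k *: (('X^2 + 'X + 1) ^+ (2 * k) * 'X^(2 * (D - k))).
have h0 : h != 0.
  (* The constant term of h is the leading coefficient of g. *)
  apply/eqP => h0; have := congr1 (horner^~ 0) h0.
  rewrite /h horner0 horner_sum big_ord_recr /= big1 => [|k _]; last first.
    rewrite hornerZ hornerM hornerXn expr0n muln_eq0 subn_eq0 /=.
    by rewrite leqNgt ltn_ord /= mulr0 mulr0.
  rewrite add0r hornerZ hornerM hornerXn subnn muln0 expr0 horner_exp.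
  have -> : ('X^2 + 'X + 1 : {poly rat}).[0] = 1.
    by rewrite -polyC1 !hornerD hornerXn hornerX hornerC expr0n /= !add0r.
  rewrite expr1n !mulr1.
  by apply/eqP; rewrite -[g`_D]/(lead_coef g) lead_coef_eq0.
have hz : root (ratrp h) z.
  have gz : (ratrp g).[((t + 1) ^+ 2)%:C%C] = 0.
    have := congr1 (real_complex R) (rootP gt).
    rewrite rmorph0 -horner_map => <-; congr (_.[_]).
    rewrite -map_poly_comp; apply: eq_map_poly => a /=.
    by rewrite fmorph_rat.
  apply/eqP.
  transitivity (z ^+ (2 * D) * (ratrp g).[((t + 1) ^+ 2)%:C%C] : R[i]); last first.
    by rewrite gz mulr0.
  rewrite (@horner_coef_wide _ D.+1 (ratrp g)); last by rewrite size_map_poly Dg.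
  rewrite /h rmorph_sum horner_sum big_distrr /=; apply: eq_bigr => k _.
  have vE : (ratrp ('X^2 + 'X + 1)).[z] = z ^+ 2 + z + 1.
    by rewrite -polyC1 !rmorphD /= map_polyXn map_polyX map_polyC /= rmorph1
      !hornerD hornerXn hornerX hornerC.
  rewrite [X in X.[z]](_ : _ =
    ratr g`_k *: (ratrp ('X^2 + 'X + 1) ^+ (2 * k) * 'X^(2 * (D - k)))); last first.
    rewrite -[LHS]/(ratrp _) map_polyZ rmorphM rmorphXn.
    by congr (_ *: (_ * _)); exact: map_polyXn.
  rewrite hornerZ hornerM hornerXn horner_exp vE coef_map -[X in _ = _ * (X * _)]/(ratr _).
  have -> : ((t + 1) ^+ 2)%:C%C = (z + z^-1 + 1) ^+ 2 :> R[i].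
    by rewrite Dt -[in RHS](rmorph1 (real_complex R)) -rmorphD -rmorphXn.
  have -> : (2 * D = 2 * (D - k) + 2 * k)%N by rewrite -mulnDr subnK // -ltnS.
  have -> : z ^+ 2 + z + 1 = z * (z + z^-1 + 1) by field.
  by move: (ratr _) (z + z^-1 + 1) => a b; rewrite exprD exprMn -[in RHS]exprM; ring.
have := totient_lt_size prim_z h0 hz.
move=> /leq_trans/(_ (size_sum _ _ _)).
move=> /leq_trans; move=> /(_ (4 * D).+1); rewrite ltnS; apply.
apply/bigmax_leqP => k _; apply: leq_trans (size_scale_leq _ _) _.
apply: leq_trans (size_polyMleq _ _) _.
rewrite size_polyXn addnS /=.
have sq : size ('X^2 + 'X + 1 : {poly rat}) = 3.
  by rewrite -addrA size_polyDl ?size_polyXn // size_polyDl ?size_polyX ?size_poly1.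
have := size_poly_exp_leq ('X^2 + 'X + 1 : {poly rat}) (2 * k).
rewrite sq /=.
move: (size _) => s sk.
have kD : (k <= D)%N by rewrite -ltnS.
apply: leq_trans (leq_add sk (leqnn _)) _.
rewrite -[(0 + _)%N]/2; lia.
Qed.

Lemma algebraic_sqr (F : numFieldType) (x : F) :
  algebraicOver ratr (x ^+ 2) -> algebraicOver ratr x.
Proof.
case=> p p_neq0 px; exists (p \Po 'X^2).
  by rewrite comp_poly_eq0 // size_polyXn.
by rewrite rootE map_comp_poly map_polyXn horner_comp hornerXn.
Qed.

(** * A rigid cyclic recurrence *)

(** Let m be the largest of all ratios S_{j+1}/S_j and of their inverses.  If it
    is attained at j+1 and exceeds 1, the recurrence reads
    S_j + 1 = m (S_{j+3} + 1), or the reverse, while the ratios at j and j+2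
    bound S_j by m S_{j+3}, so that S_j + 1 < m (S_{j+3} + 1). *)
Lemma positive_recurrence_const (F : realFieldType) (S : nat -> F) N :
  (forall j, S (j + N.+1)%N = S j) -> (forall j, 0 < S j) ->
  (forall j, (S j + 1) * S j.+1 = (S j.+3 + 1) * S j.+2) ->
  forall j, S j = S 0%N.
Proof.
move=> per S_gt0 rec.
pose M j := Num.max (S j.+1 / S j) (S j / S j.+1).
have perM j : M (j + N.+1)%N = M j by rewrite /M -addSn !per.
have perMk k j : M (j + k * N.+1)%N = M j.
  by elim: k => [|k IHk]; rewrite ?mul0n ?addn0 // mulSn addnCA addnC perM.
pose i0 := [arg max_(i > (ord0 : 'I_N.+1)) M i.+1]%O.
have Mmax j : M j <= M i0.+1.
  rewrite /i0; case: arg_maxP => // i _ imax.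
  have {}imax (l : 'I_N.+1) : M l.+1 <= M i.+1 by exact: imax.
  case: j => [|j]; first by rewrite -perM add0n; exact: (imax ord_max).
  rewrite (divn_eq j N.+1) addnC -addSn perMk.
  exact: (imax (Ordinal (ltn_pmod j (ltn0Sn N)))).
set m := M i0.+1 in Mmax.
have up j : S j.+1 <= m * S j.
  by rewrite -ler_pdivrMr // (le_trans _ (Mmax j)) // le_max lexx.
have dn j : S j <= m * S j.+1.
  by rewrite -ler_pdivrMr // (le_trans _ (Mmax j)) // le_max lexx orbT.
have m1 : m <= 1.
  rewrite leNgt; apply/negP => m_gt1.
  have := rec i0; have := up i0; have := dn i0; have := up i0.+2; have := dn i0.+2.
  have := S_gt0 i0; have := S_gt0 i0.+1; have := S_gt0 i0.+2; have := S_gt0 i0.+3.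
  (* The maximum is reached by a ratio or by an inverse ratio. *)
  have : m * S i0.+1 = S i0.+2 \/ m * S i0.+2 = S i0.+1.
    rewrite /m /M; case: leP => _; [right|left]; by rewrite divfK // gt_eqF.
  move: (S i0) (S i0.+1) (S i0.+2) (S i0.+3) => a b c d.
  case=> [mb|mc] d0 c0 b0 a0 h1 h2 h3 h4 h5.
    have e1 : a + 1 = m * (d + 1).
      by apply: (mulIf (lt0r_neq0 b0)); rewrite h5 -mb; ring.
    have e2 : b <= d by rewrite -(ler_pM2l (lt_trans ltr01 m_gt1)) mb.
    have e3 : m * b <= m * d by rewrite ler_pM2l // (lt_trans ltr01 m_gt1).
    by move: e1; rewrite mulrDr mulr1; lra.
  have e1 : d + 1 = m * (a + 1).
    by apply: (mulIf (lt0r_neq0 c0)); rewrite -h5 -mc; ring.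
  by move: e1; rewrite mulrDr mulr1; lra.
elim=> [//|j <-]; apply/eqP; rewrite eq_le.
by rewrite (le_trans (up j)) ?(le_trans (dn j)) // ler_piMl // ltW.
Qed.

(** * Lorentzian linear algebra *)

Section Minkowski.
Variable R : realType.
Implicit Types (a b c d x y z : 'rV[R]_4) (k : R).

Lemma minkowskiE x y : minkowski x y =
  - (x 0 0 * y 0 0) + (x 0 1 * y 0 1 + x 0 2 * y 0 2 + x 0 3 * y 0 3).
Proof.
rewrite /minkowski !big_ord_recr big_ord0 /= add0r.
by congr (- _ + (_ + _ + _)); congr (x 0 _ * y 0 _); apply: val_inj.
Qed.

Lemma minkowskiC x y : minkowski x y = minkowski y x.
Proof. by rewrite !minkowskiE; ring. Qed.

Lemma minkowskiDl x y z : minkowski (x + y) z = minkowski x z + minkowski y z.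
Proof. by rewrite !minkowskiE !mxE; ring. Qed.

Lemma minkowskiNl x z : minkowski (- x) z = - minkowski x z.
Proof. by rewrite !minkowskiE !mxE; ring. Qed.

Lemma minkowskiZl k x z : minkowski (k *: x) z = k * minkowski x z.
Proof. by rewrite !minkowskiE !mxE; ring. Qed.

Lemma minkowski0l z : minkowski 0 z = 0.
Proof. by rewrite !minkowskiE !mxE; ring. Qed.

Lemma minkowskiDr x y z : minkowski z (x + y) = minkowski z x + minkowski z y.
Proof. by rewrite !minkowskiE !mxE; ring. Qed.

Lemma minkowskiNr x z : minkowski z (- x) = - minkowski z x.
Proof. by rewrite !minkowskiE !mxE; ring. Qed.

Lemma minkowskiZr k x z : minkowski z (k *: x) = k * minkowski z x.
Proof. by rewrite !minkowskiE !mxE; ring. Qed.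

Definition minkowskiL := (minkowskiDl, minkowskiNl, minkowskiZl,
  minkowskiDr, minkowskiNr, minkowskiZr).

Definition mink_mx : 'M[R]_4 := diag_mx (\row_(i < 4) (if i == 0 then -1 else 1)).

Lemma minkowski_mx x y : minkowski x y = (x *m mink_mx *m y^T) 0 0.
Proof.
rewrite minkowskiE /mink_mx !mxE !big_ord_recr big_ord0 /= add0r.
rewrite !mul_mx_diag !mxE /=.
have -> : widen_ord (leqnSn 3) (widen_ord (leqnSn 2) (widen_ord (leqnSn 1) ord_max)) = 0 :> 'I_4
  by apply: val_inj.
have -> : widen_ord (leqnSn 3) (widen_ord (leqnSn 2) ord_max) = 1 :> 'I_4 by apply: val_inj.
have -> : widen_ord (leqnSn 3) ord_max = 2 :> 'I_4 by apply: val_inj.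
have -> : ord_max = 3 :> 'I_4 by apply: val_inj.
by rewrite /=; ring.
Qed.

Lemma det_mink_mx : \det mink_mx = -1.
Proof.
rewrite det_diag !big_ord_recr big_ord0 /= !mxE /=; ring.
Qed.

(** Gram matrices are evaluated through this explicit expansion; the entries
    are indexed by natural numbers so that they compute. *)
Lemma det_matrix4 (f : nat -> nat -> R) : \det (\matrix_(i < 4, j < 4) f i j) =
  f 0%N 0%N * (f 1%N 1%N * (f 2%N 2%N * f 3%N 3%N - f 2%N 3%N * f 3%N 2%N)
             - f 1%N 2%N * (f 2%N 1%N * f 3%N 3%N - f 2%N 3%N * f 3%N 1%N)
             + f 1%N 3%N * (f 2%N 1%N * f 3%N 2%N - f 2%N 2%N * f 3%N 1%N))
- f 0%N 1%N * (f 1%N 0%N * (f 2%N 2%N * f 3%N 3%N - f 2%N 3%N * f 3%N 2%N)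
             - f 1%N 2%N * (f 2%N 0%N * f 3%N 3%N - f 2%N 3%N * f 3%N 0%N)
             + f 1%N 3%N * (f 2%N 0%N * f 3%N 2%N - f 2%N 2%N * f 3%N 0%N))
+ f 0%N 2%N * (f 1%N 0%N * (f 2%N 1%N * f 3%N 3%N - f 2%N 3%N * f 3%N 1%N)
             - f 1%N 1%N * (f 2%N 0%N * f 3%N 3%N - f 2%N 3%N * f 3%N 0%N)
             + f 1%N 3%N * (f 2%N 0%N * f 3%N 1%N - f 2%N 1%N * f 3%N 0%N))
- f 0%N 3%N * (f 1%N 0%N * (f 2%N 1%N * f 3%N 2%N - f 2%N 2%N * f 3%N 1%N)
             - f 1%N 1%N * (f 2%N 0%N * f 3%N 2%N - f 2%N 2%N * f 3%N 0%N)
             + f 1%N 2%N * (f 2%N 0%N * f 3%N 1%N - f 2%N 1%N * f 3%N 0%N)).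
Proof.
rewrite (expand_det_row _ ord0) !big_ord_recr big_ord0 /= !mxE /cofactor /=.
rewrite !(expand_det_row _ ord0) !big_ord_recr !big_ord0 /= !mxE /cofactor /=.
rewrite !(expand_det_row _ ord0) !big_ord_recr !big_ord0 /= !mxE /cofactor /=.
rewrite !det_mx11 !mxE /= /bump /=.
by ring.
Qed.

Definition rows4 (a b c d : 'rV[R]_4) : 'M[R]_4 := \matrix_i [:: a; b; c; d]`_i.

Definition gram4 (a b c d : 'rV[R]_4) : 'M[R]_4 :=
  \matrix_(i, j) minkowski [:: a; b; c; d]`_i [:: a; b; c; d]`_j.

Lemma gram4E a b c d :
  gram4 a b c d = rows4 a b c d *m mink_mx *m (rows4 a b c d)^T.
Proof.
apply/matrixP => i j; rewrite mxE minkowski_mx !mxE; apply: eq_bigr => k _.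
rewrite !mxE; congr (_ * _); apply: eq_bigr => l _; by rewrite !mxE.
Qed.

Lemma det_gram4 a b c d : \det (gram4 a b c d) = - \det (rows4 a b c d) ^+ 2.
Proof. by rewrite gram4E !det_mulmx det_tr det_mink_mx; ring. Qed.

Lemma rows4_unit a b c d :
  (rows4 a b c d \in unitmx) = (\det (gram4 a b c d) != 0).
Proof. by rewrite unitmxE unitfE det_gram4 oppr_eq0 sqrf_eq0. Qed.

Lemma rows4_inj n a b c d (A B : 'M[R]_(4, n)) : rows4 a b c d \in unitmx ->
  a *m A = a *m B -> b *m A = b *m B -> c *m A = c *m B -> d *m A = d *m B ->
  A = B.
Proof.
move=> X_unit Ea Eb Ec Ed.
suff: rows4 a b c d *m A = rows4 a b c d *m B by move/(can_inj (mulKmx X_unit)).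
apply/row_matrixP => i; rewrite !row_mul !rowK.
by case: i => [[|[|[|[|i]]]] ?].
Qed.

(** Nondegeneracy: a vector is determined by its products with a basis. *)
Lemma rows4_sep a b c d x y : rows4 a b c d \in unitmx ->
  minkowski x a = minkowski y a -> minkowski x b = minkowski y b ->
  minkowski x c = minkowski y c -> minkowski x d = minkowski y d -> x = y.
Proof.
move=> X_unit Ea Eb Ec Ed.
have J_unit : mink_mx \in unitmx by rewrite unitmxE det_mink_mx unitrN unitr1.
have mE z w : w *m (mink_mx *m z^T) = (minkowski w z)%:M.
  by rewrite mulmxA [LHS]mx11_scalar minkowski_mx.
suff: mink_mx *m x^T = mink_mx *m y^T.
  by move/(can_inj (mulKmx J_unit))/trmx_inj.
apply: (rows4_inj X_unit); by rewrite !mE ![minkowski _ x]minkowskiC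
  ![minkowski _ y]minkowskiC ?Ea ?Eb ?Ec ?Ed.
Qed.

(** An orthonormal spacelike pair c, d and two unit vectors a, b of the
    Lorentzian plane orthogonal to it. *)
Definition cross_frame a b c d :=
  [/\ [/\ minkowski a a = 1, minkowski b b = 1, minkowski c c = 1 & minkowski d d = 1],
      minkowski c d = 0, minkowski a c = 0 /\ minkowski a d = 0 &
      minkowski b c = 0 /\ minkowski b d = 0].

Lemma cross_frame_det a b c d : cross_frame a b c d ->
  \det (gram4 a b c d) = 1 - minkowski a b ^+ 2.
Proof.
case=> [[aa bb cc dd] cd [ac ad] [bc bd]].
rewrite /gram4 (det_matrix4 (fun i j => minkowski [:: a; b; c; d]`_i [:: a; b; c; d]`_j)) /=.
rewrite ![minkowski b a]minkowskiC ![minkowski d a]minkowskiC ![minkowski c a]minkowskiC.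
rewrite ![minkowski d b]minkowskiC ![minkowski c b]minkowskiC ![minkowski d c]minkowskiC.
rewrite aa bb cc dd cd ac ad bc bd; ring.
Qed.

Lemma cross_frame_unit a b c d : cross_frame a b c d ->
  1 < minkowski a b ^+ 2 -> rows4 a b c d \in unitmx.
Proof.
by move=> fr lt1; rewrite rows4_unit cross_frame_det // subr_eq0 lt_eqF.
Qed.

(** The Gram determinant 1 - <a,b>^2 is nonpositive because the form has
    signature (3,1); when it vanishes, the four vectors are dependent, and a is
    proportional to b. *)
Lemma cross_frame_gt1 a b c d : cross_frame a b c d -> a <> b -> a <> - b ->
  1 < minkowski a b ^+ 2.
Proof.
move=> fr ab aNb; have Ed := cross_frame_det fr.
have : \det (gram4 a b c d) <= 0 by rewrite det_gram4 oppr_le0 sqr_ge0.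
rewrite Ed subr_le0 le_eqVlt => /predU1P[/esym p1|//]; exfalso.
have : \det (rows4 a b c d) = 0.
  by apply/eqP; rewrite -sqrf_eq0 -oppr_eq0 -det_gram4 Ed p1 subrr.
move/eqP/det0P => [v v_neq0 v0].
case: fr => [[aa bb cc dd] cd [ac ad] [bc bd]].
have {}v0 : v 0 0 *: a + v 0 1 *: b + v 0 2 *: c + v 0 3 *: d = 0.
  rewrite -v0; apply/rowP => j; rewrite !mxE !big_ord_recr big_ord0 /= add0r !mxE /=.
  by congr (_ + _ + _ + _); congr (v 0 _ * _); apply: val_inj.
have E z : v 0 0 * minkowski a z + v 0 1 * minkowski b z + v 0 2 * minkowski c z
    + v 0 3 * minkowski d z = 0.
  by rewrite -!minkowskiZl -!minkowskiDl v0 minkowski0l.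
have v2 : v 0 2 = 0.
  by have := E c; rewrite ac bc cc [minkowski d c]minkowskiC cd !mulr0 !add0r addr0 mulr1.
have v3 : v 0 3 = 0.
  by have := E d; rewrite ad bd cd dd !mulr0 !add0r mulr1.
have := E b; rewrite v2 v3 bb !mul0r !addr0 mulr1 => v1.
rewrite v2 v3 !scale0r !addr0 in v0.
have v00 : v 0 0 != 0.
  apply: contra v_neq0 => /eqP v00; apply/eqP/rowP => j; rewrite mxE.
  rewrite v00 mul0r add0r in v1.
  case: j => [[|[|[|[|j]]]] ?] //.
  - by rewrite -[RHS]v00; congr (v 0 _); apply: val_inj.
  - by rewrite -[RHS]v1; congr (v 0 _); apply: val_inj.
  - by rewrite -[RHS]v2; congr (v 0 _); apply: val_inj.
  - by rewrite -[RHS]v3; congr (v 0 _); apply: val_inj.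
have Ea : a = minkowski a b *: b.
  apply/eqP; rewrite -subr_eq0.
  suff : v 0 0 *: (a - minkowski a b *: b) == 0 by rewrite scaler_eq0 (negPf v00).
  have -> : v 0 0 *: (a - minkowski a b *: b) = v 0 0 *: a + (- (v 0 0 * minkowski a b)) *: b.
    by rewrite scalerBr scalerA scaleNr.
  have -> : - (v 0 0 * minkowski a b) = v 0 1 by apply/eqP; rewrite eqr_oppLR -addr_eq0 v1.
  by rewrite v0.
move/eqP: p1; rewrite sqrf_eq1 => /pred2P[] p1.
  by apply: ab; rewrite Ea p1 scale1r.
by apply: aNb; rewrite Ea p1 scaleN1r.
Qed.

(** In the hyperbolic plane orthogonal to e0 these are four consecutive sides of
    a right-angled pentagon, and the formula is cosh = sinh sinh.  Four
    vectors orthogonal to e0 are dependent, so their Gram determinant is zero. *)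
Lemma right_angled_chain (e0 e1 e2 e3 e4 : 'rV[R]_4) :
  minkowski e0 e0 = 1 ->
  minkowski e1 e0 = 0 -> minkowski e2 e0 = 0 -> minkowski e3 e0 = 0 -> minkowski e4 e0 = 0 ->
  minkowski e1 e1 = 1 -> minkowski e2 e2 = 1 -> minkowski e3 e3 = 1 -> minkowski e4 e4 = 1 ->
  minkowski e1 e2 = 0 -> minkowski e2 e3 = 0 -> minkowski e3 e4 = 0 ->
  minkowski e1 e4 ^+ 2 = (minkowski e1 e3 ^+ 2 - 1) * (minkowski e2 e4 ^+ 2 - 1).
Proof.
move=> e00 e10 e20 e30 e40 e11 e22 e33 e44 e12 e23 e34.
have : \det (gram4 e1 e2 e3 e4) = 0.
  apply/eqP; rewrite -[_ == 0]negbK -rows4_unit; apply/negP => X_unit.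
  suff E : e0 = 0 by move/eqP: e00; rewrite E minkowski0l eq_sym oner_eq0.
  by apply: (rows4_sep X_unit); rewrite minkowski0l minkowskiC.
rewrite /gram4 (det_matrix4 (fun i j =>
  minkowski [:: e1; e2; e3; e4]`_i [:: e1; e2; e3; e4]`_j)) /=.
rewrite ![minkowski e2 e1]minkowskiC ![minkowski e3 e1]minkowskiC ![minkowski e3 e2]minkowskiC.
rewrite ![minkowski e4 e1]minkowskiC ![minkowski e4 e2]minkowskiC ![minkowski e4 e3]minkowskiC.
rewrite e11 e22 e33 e44 e12 e23 e34 => E.
apply/eqP; rewrite -subr_eq0 -oppr_eq0 -[X in _ == X]E; apply/eqP; ring.
Qed.

Lemma hpoint_norm (x : hpoint R) : minkowski x x = -1.
Proof. by case: x => x /= /andP[/eqP]. Qed.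

Lemma hpoint_gt0 (x : hpoint R) : 0 < (x : 'rV[R]_4) 0 0.
Proof. by case: x => x /= /andP[]. Qed.

Lemma cauchy3 (a1 a2 a3 b1 b2 b3 : R) : (a1 * b1 + a2 * b2 + a3 * b3) ^+ 2 <=
    (a1 ^+ 2 + a2 ^+ 2 + a3 ^+ 2) * (b1 ^+ 2 + b2 ^+ 2 + b3 ^+ 2).
Proof.
rewrite -subr_ge0.
have -> : (a1 ^+ 2 + a2 ^+ 2 + a3 ^+ 2) * (b1 ^+ 2 + b2 ^+ 2 + b3 ^+ 2)
    - (a1 * b1 + a2 * b2 + a3 * b3) ^+ 2 = (a1 * b2 - a2 * b1) ^+ 2
    + (a1 * b3 - a3 * b1) ^+ 2 + (a2 * b3 - a3 * b2) ^+ 2 by ring.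
by rewrite !addr_ge0 ?sqr_ge0.
Qed.

Lemma future_timelike (w : 'rV[R]_4) (x : hpoint R) :
  minkowski w w < 0 -> 0 < w 0 0 -> minkowski x w < 0.
Proof.
move=> ww w0; have x0 := hpoint_gt0 x; have xx := hpoint_norm x.
rewrite ltNge; apply/negP => xw; move: ww xx xw; rewrite !minkowskiE.
have := cauchy3 ((x : 'rV_4) 0 1) ((x : 'rV_4) 0 2) ((x : 'rV_4) 0 3) (w 0 1) (w 0 2) (w 0 3).
move: w0 x0.
have : 0 <= hval x 0 1 ^+ 2 + hval x 0 2 ^+ 2 + hval x 0 3 ^+ 2.
  by rewrite !addr_ge0 ?sqr_ge0.
rewrite -!expr2.
move: (hval x 0 0) (w 0 0) (_ + _ * w 0 3) (_ + hval x 0 3 ^+ 2) (_ + w 0 3 ^+ 2).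
move=> a0 b0 s X2 W2 X20 b0_gt0 x0 cs ww xx xw.
have {}xx : X2 = a0 ^+ 2 - 1 by lra.
have {}ww : W2 < b0 ^+ 2 by lra.
have {}xw : a0 * b0 <= s by lra.
have h1 : (a0 * b0) ^+ 2 <= s ^+ 2.
  by rewrite ler_sqr // ?nnegrE; [rewrite mulr_ge0 // ltW
      | rewrite (le_trans _ xw) // mulr_ge0 // ltW].
have h2 : X2 * W2 <= X2 * b0 ^+ 2 by rewrite ler_wpM2l ?(ltW ww).
have h3 : 0 < b0 ^+ 2 by rewrite exprn_gt0.
have := le_trans h1 (le_trans cs h2); rewrite xx exprMn => h4; lra.
Qed.

(** All points of the hyperboloid lie on the same side of a timelike vector. *)
Lemma timelike_sign (w : 'rV[R]_4) (x y : hpoint R) :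
  minkowski w w < 0 -> minkowski x w < 0 -> minkowski y w < 0.
Proof.
move=> ww xw; have [w0|w0|w0] := ltgtP 0 (w 0 0).
- exact: future_timelike.
- have := @future_timelike (- w) x; rewrite !minkowskiL mxE oppr_gt0 opprK oppr_lt0.
  by move=> /(_ ww w0) /(lt_trans xw); rewrite ltxx.
- move: ww; rewrite minkowskiE -w0 mul0r oppr0 add0r ltNge.
  by rewrite !addr_ge0 ?sqr_ge0.
Qed.

(** The hyperplane orthogonal to a point of the hyperboloid is positive. *)
Lemma spacelike_complement (v : 'rV[R]_4) (x : hpoint R) :
  minkowski x v = 0 -> 0 <= minkowski v v.
Proof.
move=> xv; rewrite leNgt; apply/negP => vv.
have [v0|v0|v0] := ltgtP 0 (v 0 0).
- by have := future_timelike x vv v0; rewrite xv ltxx.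
- have := @future_timelike (- v) x; rewrite !minkowskiL mxE oppr_gt0 opprK.
  by move=> /(_ vv v0); rewrite xv oppr0 ltxx.
- move: vv; rewrite minkowskiE -v0 mul0r oppr0 add0r ltNge.
  by rewrite !addr_ge0 ?sqr_ge0.
Qed.

(** Reversed Cauchy-Schwarz inequality: v is the component of y orthogonal
    to x. *)
Lemma hpoint_mink_le (x y : hpoint R) : minkowski x y <= -1.
Proof.
rewrite leNgt; apply/negP => xy.
have xyn : minkowski x y < 0.
  apply: future_timelike; rewrite ?hpoint_norm ?ltrN10 //; exact: hpoint_gt0.
pose v : 'rV[R]_4 := (y : 'rV[R]_4) + minkowski x y *: (x : 'rV[R]_4).
have xv : minkowski x v = 0 by rewrite /v !minkowskiL hpoint_norm; ring.
have := spacelike_complement xv.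
rewrite /v !minkowskiL !hpoint_norm [minkowski y x]minkowskiC.
by move: (minkowski x y) xy xyn => p *; nra.
Qed.

End Minkowski.

(** * Faces of acute polyhedra *)

Section Polyhedron.
Variables (R : realType) (F : finType) (e : F -> 'rV[R]_4).
Hypothesis poly_e : is_hpolyhedron e.
Implicit Types a b : F.

Lemma normal_unit a : minkowski (e a) (e a) = 1.
Proof. by case: poly_e => /(_ a). Qed.

Lemma normal_neq a b : a != b -> e a <> e b.
Proof.
move=> ab eab; case: poly_e => _ _ /(_ a)[x xa /(_ b)].
by rewrite eq_sym ab -eab xa ltxx => /(_ isT).
Qed.

Lemma normal_neqN a b : e a <> - e b.
Proof.
move=> eab; case: poly_e => _ [x xe] _; have := xe a.
by rewrite eab minkowskiNr oppr_lt0 => /(lt_trans (xe b)); rewrite ltxx.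
Qed.

(** If the product p exceeded 1, the two half-spaces would be nested and one of
    the planes would not carry a face.  Algebraically: the component w of the
    normal of b orthogonal to the normal of a is timelike, and a point of the
    face of a shows on which side of w the polyhedron lies; the same for w';
    the sum w + w' = (1 - p)(e a + e b) then gives 1 - p > 0. *)
Lemma ultraparallel_sign a b : a != b -> 1 < minkowski (e a) (e b) ^+ 2 ->
  minkowski (e a) (e b) < -1.
Proof.
move=> ab p1; case: poly_e => _ [y ye] faces.
set p := minkowski (e a) (e b) in p1 *.
have [xa xaa xab] := faces a; have [xb xbb xba] := faces b.
pose w := e b - p *: e a; pose w' := e a - p *: e b.
have ww : minkowski w w < 0.
  rewrite /w !minkowskiL !normal_unit [minkowski (e b) (e a)]minkowskiC -/p; nra.
have ww' : minkowski w' w' < 0.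
  rewrite /w' !minkowskiL !normal_unit [minkowski (e b) (e a)]minkowskiC -/p; nra.
have yw : minkowski y w < 0.
  apply: (timelike_sign (x := xa)) => //.
  by rewrite /w !minkowskiL xaa mulr0 oppr0 addr0 xab // eq_sym.
have yw' : minkowski y w' < 0.
  apply: (timelike_sign (x := xb)) => //.
  by rewrite /w' !minkowskiL xbb mulr0 oppr0 addr0 xba.
move: yw yw'; rewrite /w /w' !minkowskiL.
have := ye a; have := ye b; move: (minkowski y _) (minkowski y _) p1 => s t p1 s0 t0 h1 h2.
nra.
Qed.

(** [acos] only determines numbers in [-1, 1]; the product of the normals is
    there because both are orthogonal to a common point. *)
Lemma right_angle_orthogonal a b : a != b -> share_edge e a b ->
  dihedral_angle e a b = pi / 2 -> minkowski (e a) (e b) = 0.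
Proof.
move=> ab [x [_ [_ [[_ /= xa] [_ /= xb]] _]]] ang.
set p := minkowski (e a) (e b) in ang *.
have p1 : p ^+ 2 <= 1.
  have := @spacelike_complement _ (e b - p *: e a) x.
  rewrite !minkowskiL xa xb mulr0 oppr0 addr0 => /(_ erefl).
  by rewrite !normal_unit [minkowski (e b) (e a)]minkowskiC -/p; nra.
have pI : - p \in `[(-1), 1].
  by rewrite in_itv /=; apply/andP; split; nra.
have := acosK pI; move: ang; rewrite /dihedral_angle -/p => ->.
by rewrite cos_pihalf => /esym/eqP; rewrite oppr_eq0 => /eqP.
Qed.

End Polyhedron.

(** * The geometry of a Loebell polyhedron *)

Section Lobell.
Variables (R : realType) (n : nat) (e : lobell_face n -> 'rV[R]_4).
Hypotheses (n_ge5 : (5 <= n)%N) (lob_e : is_lobell e).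

(** The lateral faces in zigzag order: two faces are adjacent when their
    positions differ by 1 (one upper, one lower) or by 2 (same ring).  Positions
    are natural numbers, read modulo 2n. *)
Definition lateral (j : nat) : lobell_face n :=
  if odd j then Lower (j./2.+1)%:R else Upper (j./2)%:R.

(** The cap adjacent to the lateral face in position j. *)
Definition cap (j : nat) : lobell_face n := if odd j then Bottom else Top.

Local Notation w j := (e (lateral j)).
Local Notation h j := (e (cap j)).

Lemma natZ_eq i j : (i%:R == j%:R :> 'Z_n) = (i == j %[mod n])%N.
Proof.
have n1 : (1 < n)%N by apply: leq_trans n_ge5.
by rewrite -val_eqE /= !val_Zp_nat.
Qed.

Lemma lateral_double i : lateral i.*2 = Upper i%:R.
Proof. by rewrite /lateral odd_double doubleK. Qed.

Lemma lateral_doubleS i : lateral i.*2.+1 = Lower i.+1%:R.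
Proof. by rewrite /lateral /= odd_double /= uphalf_double. Qed.

Lemma lateral_period j : lateral (j + n.*2) = lateral j.
Proof.
have nE i : (i + n)%:R = i%:R :> 'Z_n by apply/eqP; rewrite natZ_eq modnDr.
rewrite /lateral oddD odd_double addbF halfD odd_double andbF add0n doubleK.
by rewrite -addSn !nE.
Qed.

Lemma cap_SS j : cap j.+2 = cap j.
Proof. by rewrite /cap /= negbK. Qed.

Lemma cap_period j : cap (j + n.*2) = cap j.
Proof. by rewrite /cap oddD odd_double addbF. Qed.

Lemma lateral_neq j d : (0 < d < 5)%N -> lateral j != lateral (j + d).
Proof.
move=> /andP[d0 d5].
have [oE|oNE] := boolP (odd d).
  by rewrite /lateral oddD oE addbT; case: (odd j).
have dE : d = d./2.*2 by rewrite -[LHS]odd_double_half (negPf oNE).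
have d2 : (0 < d./2 < n)%N by lia.
have nE i : i%:R != (i + d./2)%:R :> 'Z_n.
  by rewrite natZ_eq -[X in X == _ %[mod n]]addn0 eqn_modDl mod0n modn_small; lia.
rewrite /lateral oddD (negPf oNE) addbF halfD (negPf oNE) andbF add0n.
case: (odd j); apply/eqP => [] [] /eqP; first by rewrite -addSn (negPf (nE _)).
by rewrite (negPf (nE _)).
Qed.

(** Adjacent faces share an edge, along which the angle is right. *)
Lemma adjacent_orthogonal a b : a != b -> lobell_adjacent a b ->
  minkowski (e a) (e b) = 0.
Proof.
move=> ab adj; case: lob_e => lobell_hpolyhedron _ edge angle.
have sh : share_edge e a b by apply/edge.
exact: right_angle_orthogonal (angle a b ab sh).
Qed.

Lemma lobell_hpolyhedron : is_hpolyhedron e. Proof. by case: lob_e. Qed.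

Lemma lateral_norm j : minkowski (w j) (w j) = 1.
Proof. exact: (normal_unit lobell_hpolyhedron). Qed.

Lemma lateral_orthogonal1 j : minkowski (w j) (w j.+1) = 0.
Proof.
apply: adjacent_orthogonal; first by rewrite -addn1 lateral_neq.
rewrite -[j]odd_double_half; case: (odd j); rewrite ?add0n ?add1n.
  by rewrite -doubleS lateral_doubleS lateral_double /= eqxx.
by rewrite lateral_doubleS lateral_double /= -natr1 eqxx orbT.
Qed.

Lemma lateral_orthogonal2 j : minkowski (w j) (w j.+2) = 0.
Proof.
apply: adjacent_orthogonal; first by rewrite -addn2 lateral_neq.
rewrite -[j]odd_double_half; case: (odd j); rewrite ?add0n ?add1n -?doubleS.
  by rewrite -[X in lateral X.+2]/(j./2.*2.+1) -doubleS !lateral_doubleS /= -[j./2.+2%:R]natr1 eqxx.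
by rewrite !lateral_double /= -natr1 eqxx.
Qed.

Lemma cap_norm j : minkowski (h j) (h j) = 1.
Proof. exact: (normal_unit lobell_hpolyhedron). Qed.

Lemma cap_orthogonal j : minkowski (h j) (w j) = 0.
Proof.
by apply: adjacent_orthogonal; rewrite /cap /lateral; case: (odd j).
Qed.

Lemma cap_orthogonal2 j : minkowski (h j) (w j.+2) = 0.
Proof. by rewrite -cap_SS cap_orthogonal. Qed.

(* S j is sinh^2 of the length of the edge between the lateral faces in
   positions j and j+2, which joins cap j to the face in position j+1; Z j is
   sinh^2 of the length of the zigzag edge between positions j+1 and j+2. *)
Let S j := minkowski (h j) (w j.+1) ^+ 2 - 1.
Let Z j := minkowski (w j) (w j.+3) ^+ 2 - 1.

Lemma cap_lateral_neq i j : cap i != lateral j.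
Proof. by rewrite /cap /lateral; case: (odd i); case: (odd j). Qed.

Lemma cap_lateral_frame j : cross_frame (h j) (w j.+1) (w j) (w j.+2).
Proof.
split; [split; rewrite ?lateral_norm ?cap_norm //
  | exact: lateral_orthogonal2
  | rewrite cap_orthogonal cap_orthogonal2 // |].
by rewrite minkowskiC lateral_orthogonal1 lateral_orthogonal1.
Qed.

Lemma lateral_frame j : cross_frame (w j) (w j.+3) (w j.+1) (w j.+2).
Proof.
split; [split; rewrite ?lateral_norm //
  | exact: lateral_orthogonal1
  | rewrite lateral_orthogonal1 lateral_orthogonal2 // |].
by split; rewrite minkowskiC ?lateral_orthogonal1 ?lateral_orthogonal2.
Qed.

Lemma S_gt0 j : 0 < S j.
Proof.
rewrite subr_gt0; apply: cross_frame_gt1 (cap_lateral_frame j) _ _.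
  exact: (normal_neq lobell_hpolyhedron (cap_lateral_neq _ _)).
exact: (normal_neqN lobell_hpolyhedron).
Qed.

Lemma Z_gt0 j : 0 < Z j.
Proof.
rewrite subr_gt0; apply: cross_frame_gt1 (lateral_frame j) _ _.
  by apply: (normal_neq lobell_hpolyhedron); rewrite -addn3 lateral_neq.
exact: (normal_neqN lobell_hpolyhedron).
Qed.

(** The right-angled pentagon on the face in position j+2, read in one
    direction; [pentagon_zigzag] reads it in the other. *)
Lemma pentagon_zigzag_next j : S j + 1 = S j.+2 * Z j.+1.
Proof.
rewrite /S subrK /Z cap_SS.
rewrite (@right_angled_chain _ (w j.+2) (h j) (w j.+4) (w j.+3) (w j.+1));
  rewrite ?lateral_norm ?cap_norm ?lateral_orthogonal1 ?lateral_orthogonal2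
    ?cap_orthogonal2 //
    1?minkowskiC ?lateral_orthogonal1 ?lateral_orthogonal2 ?cap_orthogonal
    ?cap_orthogonal2 //.
  by rewrite [minkowski (w j.+4) _]minkowskiC.
by rewrite minkowskiC -cap_SS cap_orthogonal2.
Qed.

Lemma pentagon_zigzag j : S j.+2 + 1 = S j * Z j.
Proof.
rewrite /S subrK /Z cap_SS.
rewrite (@right_angled_chain _ (w j.+2) (h j) (w j) (w j.+1) (w j.+3));
  rewrite ?lateral_norm ?cap_norm ?lateral_orthogonal1 ?lateral_orthogonal2 ?cap_orthogonal2 ?cap_orthogonal //
    1?minkowskiC ?lateral_orthogonal1 ?lateral_orthogonal2 ?cap_orthogonal
    ?cap_orthogonal2 //.
Qed.

(** Both pentagon relations express Z, so S satisfies the cyclic recurrence of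
    [positive_recurrence_const]. *)
Lemma S_const j : S j = S 0%N.
Proof.
have n2 : (0 < n.*2)%N by lia.
apply: (@positive_recurrence_const _ S n.*2.-1) => [i|i|i]; rewrite ?prednK //.
- by rewrite /S -addSn lateral_period cap_period.
- exact: S_gt0.
by rewrite pentagon_zigzag_next pentagon_zigzag; ring.
Qed.

Lemma Z_const j : Z j = Z 0%N.
Proof.
apply: (mulfI (lt0r_neq0 (S_gt0 0))).
by rewrite -{1}(S_const j) -!pentagon_zigzag !S_const.
Qed.

(** The hyperbolic cosine of the edge length of the caps, which is
    1 + 2 cos (2 pi / n) for the regular right-angled n-gon. *)
Definition lobell_modulus := - minkowski (e (lateral 0)) (e (lateral 4)).
Local Notation m := lobell_modulus.

(** The third relation of the pentagon gives the square, and
    [ultraparallel_sign] the sign. *)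
Lemma lateral_skip4_const j : minkowski (w j) (w j.+4) = - Z 0%N.
Proof.
have E : minkowski (w j) (w j.+4) ^+ 2 = Z 0%N ^+ 2.
  rewrite (@right_angled_chain _ (w j.+2) (w j) (w j.+1) (w j.+3) (w j.+4));
    rewrite ?lateral_norm ?lateral_orthogonal1 ?lateral_orthogonal2 //
      1?minkowskiC ?lateral_orthogonal1 ?lateral_orthogonal2 //.
  rewrite [minkowski (w j.+3) _]minkowskiC.
  by rewrite -[X in _ * X]/(Z j.+1) -[X in X * _]/(Z j) !Z_const expr2.
have Z1 : 1 < Z 0%N.
  by have := pentagon_zigzag 0; rewrite (S_const 2); have := S_gt0 0; move: (S 0) (Z 0) => s z; nra.
have : minkowski (w j) (w j.+4) < -1.
  apply: (ultraparallel_sign lobell_hpolyhedron); first by rewrite -addn4 lateral_neq.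
  by rewrite E; nra.
by move/eqP: E; rewrite eqf_sqr => /pred2P[] -> //; lra.
Qed.

Lemma lobell_modulusE : m = Z 0%N.
Proof. by rewrite /m lateral_skip4_const opprK. Qed.

Lemma lobell_modulus_gt1 : 1 < m.
Proof.
rewrite lobell_modulusE.
by have := pentagon_zigzag 0; rewrite (S_const 2); have := S_gt0 0; move: (S 0) (Z 0) => s z; nra.
Qed.

Lemma lateral_skip4 j : minkowski (w j) (w j.+4) = - m.
Proof. by rewrite lateral_skip4_const lobell_modulusE. Qed.

Local Notation a := (Num.sqrt (m + 1)).

Lemma sqr_zigzag : a ^+ 2 = m + 1.
Proof. by rewrite sqr_sqrtr //; have := lobell_modulus_gt1; lra. Qed.

Lemma lateral_skip3 j : minkowski (w j) (w j.+3) = - a.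
Proof.
have E : minkowski (w j) (w j.+3) ^+ 2 = a ^+ 2.
  by rewrite sqr_zigzag lobell_modulusE -(Z_const j) /Z subrK.
have : minkowski (w j) (w j.+3) < -1.
  apply: (ultraparallel_sign lobell_hpolyhedron); first by rewrite -addn3 lateral_neq.
  by rewrite E sqr_zigzag; have := lobell_modulus_gt1; lra.
have : 0 <= a by rewrite sqrtr_ge0.
by move/eqP: E; rewrite eqf_sqr => /pred2P[] -> //; lra.
Qed.

(** Periodicity turns the position j into a successor, where [S] is defined. *)
Lemma cap_lateral j : minkowski (h j.+1) (w j) ^+ 2 = m / (m - 1).
Proof.
have n2 : (0 < n.*2)%N by lia.
have -> : minkowski (h j.+1) (w j) ^+ 2 = S (j + n.*2.-1)%N + 1.
  have capE : cap (j + n.*2.-1) = cap j.+1.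
    by rewrite -cap_SS -!addnS prednK // addnS -addSn cap_period.
  by rewrite /S subrK capE -addnS prednK // lateral_period.
have := pentagon_zigzag 0; rewrite (S_const (0 + 2)) -lobell_modulusE S_const.
have := lobell_modulus_gt1; move: m (S 0) => z s z1 E.
have s0 : z - 1 != 0 by rewrite gt_eqF // subr_gt0.
apply: (mulIf s0); rewrite divfK //; lra.
Qed.

Lemma rows4_lateral j : rows4 (w j) (w j.+3) (w j.+1) (w j.+2) \in unitmx.
Proof.
apply: cross_frame_unit (lateral_frame j) _.
by rewrite lateral_skip3 sqrrN sqr_zigzag; have := lobell_modulus_gt1; lra.
Qed.

(** Both sides have the same products with the basis w_j, ..., w_{j+3}. *)
Lemma lateral_rec j : w j.+4 = w j + a *: w j.+3 - a *: w j.+1.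
Proof.
apply: (rows4_sep (rows4_lateral j)); rewrite !minkowskiL ?lateral_norm.
- rewrite minkowskiC lateral_skip4 [minkowski (w j.+3) _]minkowskiC lateral_skip3.
  by rewrite [minkowski (w j.+1) _]minkowskiC lateral_orthogonal1 mulrN -expr2 sqr_zigzag; ring.
- by rewrite minkowskiC lateral_orthogonal1 lateral_skip3 lateral_orthogonal2; ring.
- rewrite minkowskiC lateral_skip3 lateral_orthogonal1
    [minkowski (w j.+3) _]minkowskiC lateral_orthogonal2; ring.
- rewrite minkowskiC lateral_orthogonal2 lateral_orthogonal2
    [minkowski (w j.+3) _]minkowskiC !lateral_orthogonal1; ring.
Qed.

(* The normals of the upper ring, and their successive differences. *)
Let u i := w i.*2.
Let y i := u i.+1 - u i.
Local Notation t := (m - 1).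

Lemma step_rec i : y i.+2 = t *: y i.+1 - y i.
Proof.
have tE : t = a ^+ 2 - 2 by rewrite sqr_zigzag; ring.
rewrite /y /u !doubleS; have := lateral_rec i.*2; have := lateral_rec i.*2.+1.
have := lateral_rec i.*2.+2; rewrite tE => -> -> E.
apply/eqP; rewrite -subr_eq0; apply/eqP.
apply/rowP => l; move/rowP/(_ l): E; rewrite !mxE.
move: (a) => b E; rewrite E; ring.
Qed.

Lemma step_cheb k i : y (i + k).+1 = cheb t k.+1 *: y i.+1 - cheb t k *: y i.
Proof.
suff [] : y (i + k).+1 = cheb t k.+1 *: y i.+1 - cheb t k *: y i /\
          y (i + k).+2 = cheb t k.+2 *: y i.+1 - cheb t k.+1 *: y i by [].
elim: k => [|k [IH1 IH2]].
  by rewrite addn0 step_rec /= scale1r scale0r !subr0 mulr1 scale1r.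
rewrite addnS; split=> //; rewrite step_rec IH1 IH2.
rewrite (chebSS t k.+1) (chebSS t k).
by apply/rowP => l; rewrite !mxE; ring.
Qed.

Lemma upper_norm i : minkowski (u i) (u i) = 1. Proof. exact: lateral_norm. Qed.
Lemma upper_orthogonal i : minkowski (u i) (u i.+1) = 0.
Proof. by rewrite /u doubleS lateral_orthogonal2. Qed.
Lemma upper_skip i : minkowski (u i) (u i.+2) = - m.
Proof. by rewrite /u !doubleS lateral_skip4. Qed.

Lemma step_free (c d : R) : c *: y 1 + d *: y 0 = 0 -> c = 0 /\ d = 0.
Proof.
move=> E.
have E1 : minkowski (c *: y 1 + d *: y 0) (u 1) = 0 by rewrite E minkowski0l.
have E0 : minkowski (c *: y 1 + d *: y 0) (u 0) = 0 by rewrite E minkowski0l.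
move: E1 E0; rewrite /y !minkowskiL !upper_norm ![minkowski (u 2) _]minkowskiC.
rewrite upper_skip !upper_orthogonal [minkowski (u 1) (u 0)]minkowskiC upper_orthogonal => E1 E0.
have cd : c = d by lra.
have : d * (m + 1) = 0 by rewrite -[RHS]oppr0 -E0 cd; ring.
move/eqP; rewrite mulf_eq0 orbC gt_eqF /= => [/eqP d0|]; first by rewrite cd d0.
by have := lobell_modulus_gt1; lra.
Qed.

Lemma upper_period i : u (i + n) = u i.
Proof. by rewrite /u doubleD lateral_period. Qed.

(** y_n = y_0, written in the free family y_1, y_0. *)
Lemma lobell_cheb : cheb t n = 0 /\ cheb t n.-1 = -1.
Proof.
have n0 : (0 < n)%N by lia.
have : cheb t n *: y 1 - cheb t n.-1 *: y 0 = y 0.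
  rewrite -{1}(prednK n0) -step_cheb add0n prednK //.
  by rewrite /y -[n]add0n -addSn !upper_period.
move/eqP; rewrite -subr_eq0 => /eqP E.
have [|-> E1] := @step_free (cheb t n) (- (cheb t n.-1 + 1)).
  rewrite -[RHS]E; apply/rowP => l; rewrite !mxE; ring.
by split=> //; lra.
Qed.

(** Another period d of the differences y makes u_{i+d} - u_i a constant k;
    iterating n times, n k = 0 by periodicity of u, so that u itself has period
    d.  Distinct faces have distinct normals, hence n divides d. *)
Lemma lobell_cheb_order d : cheb t d = 0 -> cheb t d.+1 = 1 -> (n %| d)%N.
Proof.
move=> d0 d1.
have yd i : y (i + d).+1 = y i.+1 by rewrite step_cheb d0 d1 scale1r scale0r subr0.
pose k := u d.+1 - u 1.
have uk i : u (i + d).+1 = u i.+1 + k.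
  elim: i => [|i IHi]; first by rewrite /k addrC subrK.
  have -> : u i.+2 = y i.+1 + u i.+1 by rewrite /y subrK.
  by rewrite -yd -addrA -IHi /y subrK.
have ukm i : u (i * d).+1 = u 1 + k *+ i.
  elim: i => [|i IHi]; first by rewrite mulr0n addr0.
  by rewrite mulSn addnC uk IHi mulrS -addrA [_ + k]addrC.
have per i : u (1 + i * n)%N = u 1.
  by elim: i => [|i IHi]; rewrite ?addn0 // mulSn addnCA addnC upper_period.
have k0 : k = 0.
  have := ukm n; rewrite [(n * d)%N]mulnC -[(d * n).+1]add1n per => /eqP.
  rewrite -[X in X == _]addr0 (inj_eq (addrI _)) eq_sym -scaler_nat scaler_eq0.
  by rewrite pnatr_eq0 => /orP[/eqP n0|/eqP //]; move: n_ge5; rewrite n0.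
have /eqP E : u d.+1 = u 1 by have := uk 0; rewrite k0 addr0.
apply/negPn/negP => nd; move/eqP: E; apply: (normal_neq lobell_hpolyhedron).
rewrite !lateral_double; apply/eqP => [] [] /eqP; rewrite natZ_eq.
by rewrite -[X in _ == X %[mod n]]addn0 -add1n eqn_modDl mod0n; apply/negP.
Qed.

Local Notation alg := (algebraicOver (ratr : rat -> R)).
Let ratrM := (ratr : {rmorphism rat -> R}).

Lemma lobell_modulus_algebraic : alg m.
Proof.
have n0 : (0 < n)%N by lia.
rewrite -[m](subrK 1); apply: (algebraic_add (FtoE := ratrM)).
  by apply: (@cheb_root_algebraic _ _ n.-1); rewrite prednK // (proj1 lobell_cheb).
exact: (algebraic1 ratrM).
Qed.

Lemma zigzag_algebraic : alg a.
Proof.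
apply: algebraic_sqr; rewrite sqr_zigzag; apply: (algebraic_add (FtoE := ratrM)).
  exact: lobell_modulus_algebraic.
exact: (algebraic1 ratrM).
Qed.

Lemma lateral_algebraic j k : alg (minkowski (w j) (w (j + k)%N)).
Proof.
have h0 : alg 0 by exact: (algebraic0 ratrM).
elim/ltn_ind: k => [[|[|[|[|k]]]]] IHk; rewrite ?addn0 ?addn1 ?addn2 ?addn3.
- by rewrite lateral_norm; exact: (algebraic1 ratrM).
- by rewrite lateral_orthogonal1.
- by rewrite lateral_orthogonal2.
- rewrite lateral_skip3; apply: (algebraic_opp (FtoE := ratrM)); exact: zigzag_algebraic.
rewrite !addnS lateral_rec !minkowskiL.
apply: (algebraic_add (FtoE := ratrM)); first apply: (algebraic_add (FtoE := ratrM)).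
- by apply: IHk; lia.
- apply: (algebraic_mul (FtoE := ratrM)); first exact: zigzag_algebraic.
  by rewrite -!addnS; apply: IHk; lia.
- apply: (algebraic_opp (FtoE := ratrM)); apply: (algebraic_mul (FtoE := ratrM)).
    exact: zigzag_algebraic.
  by rewrite -!addnS; apply: IHk; lia.
Qed.

Lemma cap_lateral_algebraic i j : alg (minkowski (h i) (w j)).
Proof.
have [E|E] := eqVneq (odd i) (odd j).
  by rewrite /cap E -/(cap j) cap_orthogonal; exact: (algebraic0 ratrM).
have -> : cap i = cap j.+1.
  by rewrite /cap /=; move: E; case: (odd i); case: (odd j).
apply: algebraic_sqr; rewrite cap_lateral; apply: (algebraic_div (FtoE := ratrM)).
  exact: lobell_modulus_algebraic.
apply: (algebraic_sub (FtoE := ratrM)); first exact: lobell_modulus_algebraic.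
exact: (algebraic1 ratrM).
Qed.

(** The normal of the top is expanded in the basis w_0, w_1, w_2, w_3. *)
Lemma cap_cap_algebraic : alg (minkowski (e Top) (e Bottom)).
Proof.
have T0 : Top = cap 0 by []. have B1 : Bottom = cap 1 by [].
pose t1 := minkowski (e Top) (w 1%N); pose t3 := minkowski (e Top) (w 3%N).
pose c := - t3 / m.
have m0 : m != 0 by rewrite gt_eqF //; have := lobell_modulus_gt1; lra.
have hww0 i : minkowski (w i) (h i) = 0 by rewrite minkowskiC cap_orthogonal.
have -> : e Top = (a * c) *: w 0%N + t1 *: w 1%N + c *: w 3%N.
  have cE : c * m = - t3 by rewrite /c divfK.
  apply: (rows4_sep (rows4_lateral 0)); rewrite !minkowskiL ?lateral_norm.
  - rewrite {1}T0 cap_orthogonal [minkowski (w 1%N) _]minkowskiC lateral_orthogonal1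
      [minkowski (w 3%N) _]minkowskiC lateral_skip3; ring.
  - rewrite -[LHS]/t3 lateral_skip3 lateral_orthogonal2 -[LHS]opprK -cE.
    have -> : a * c * - a = - (c * a ^+ 2) by ring.
    rewrite sqr_zigzag; ring.
  - by rewrite -[LHS]/t1 lateral_orthogonal1
      [minkowski (w 3%N) _]minkowskiC lateral_orthogonal2; ring.
  - by rewrite {1}T0 cap_orthogonal2 lateral_orthogonal2 lateral_orthogonal1
      [minkowski (w 3%N) _]minkowskiC lateral_orthogonal1; ring.
rewrite !minkowskiL {2}B1 hww0 (_ : minkowski (w 3%N) (e Bottom) = 0) ?mulr0 ?addr0; last first.
  by rewrite -[Bottom]/(cap 3) hww0.
apply: (algebraic_mul (FtoE := ratrM)); last first.
  by rewrite minkowskiC B1; exact: cap_lateral_algebraic.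
apply: (algebraic_mul (FtoE := ratrM)); first exact: zigzag_algebraic.
apply: (algebraic_div (FtoE := ratrM)); last exact: lobell_modulus_algebraic.
apply: (algebraic_opp (FtoE := ratrM)); rewrite /t3 T0; exact: cap_lateral_algebraic.
Qed.

Lemma lobell_face_cases f : [\/ f = Top, f = Bottom | exists j, f = lateral j].
Proof.
have n1 : (1 < n)%N by apply: leq_trans n_ge5.
case: f => [||i|i]; [by constructor 1|by constructor 2|constructor 3|constructor 3].
  by exists i.*2; rewrite lateral_double natr_Zp.
exists (i + n.-1).*2.+1; rewrite lateral_doubleS -addnS prednK; last lia.
by rewrite natrD pchar_Zp // addr0 natr_Zp.
Qed.

Lemma lobell_gram_algebraic f g : alg (minkowski (e f) (e g)).
Proof.
have a1 : alg 1 by exact: (algebraic1 ratrM).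
have norm1 b : alg (minkowski (e b) (e b)) by rewrite (normal_unit lobell_hpolyhedron).
case: (lobell_face_cases f) (lobell_face_cases g) => [->|->|[i ->]] [->|->|[j ->]].
- exact: norm1.
- exact: cap_cap_algebraic.
- exact: (cap_lateral_algebraic 0).
- by rewrite minkowskiC; exact: cap_cap_algebraic.
- exact: norm1.
- exact: (cap_lateral_algebraic 1).
- by rewrite minkowskiC; exact: (cap_lateral_algebraic 0).
- by rewrite minkowskiC; exact: (cap_lateral_algebraic 1).
case: (leqP i j) => ij; first by rewrite -(subnKC ij); exact: lateral_algebraic.
by rewrite minkowskiC -(subnKC (ltnW ij)); exact: lateral_algebraic.
Qed.

End Lobell.

(** * Isometries as Lorentz matrices *)

Local Open Scope classical_set_scope.

Section Isometries.
Variable R : realType.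
Implicit Types (x y z : hpoint R) (g h : hisometry R) (A B : 'M[R]_4).
Local Notation J := (mink_mx R).

Lemma minkowskiM (x y : 'rV[R]_4) : x *m (J *m y^T) = (minkowski x y)%:M.
Proof. by rewrite mulmxA [LHS]mx11_scalar minkowski_mx. Qed.

Lemma arcosh_inj : {in [pred c : R | 1 <= c] &, injective (@arcosh R)}.
Proof.
suff lt (c d : R) : 1 <= c -> c < d -> arcosh c < arcosh d.
  move=> c d; rewrite !inE => c1 d1 E.
  have [cd|dc|//] := ltgtP c d.
    by have := lt c d c1 cd; rewrite E ltxx.
  by have := lt d c d1 dc; rewrite E ltxx.
move=> c1 cd; have d1 : 1 <= d by rewrite (le_trans c1) // ltW.
have s0 (b : R) : 0 <= Num.sqrt (b ^+ 2 - 1) by rewrite sqrtr_ge0.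
have s1 : Num.sqrt (c ^+ 2 - 1) <= Num.sqrt (d ^+ 2 - 1).
  by rewrite ler_wsqrtr // lerD2r ler_sqr ?nnegrE; lra.
have := s0 c; have := s0 d; rewrite /arcosh.
move: (Num.sqrt (c ^+ 2 - 1)) (Num.sqrt (d ^+ 2 - 1)) s1 => s t st t0 s0'.
by rewrite ltr_ln ?posrE; lra.
Qed.

(** Distances determine products, because arcosh is injective on [1, +oo). *)
Lemma hisometry_minkowski g x y : minkowski (g x) (g y) = minkowski x y.
Proof.
have E := hiso_dist g x y.
apply: oppr_inj; apply: arcosh_inj => //; rewrite inE /= lerNr; exact: hpoint_mink_le.
Qed.

(** Matrices act on row vectors on the right, so products are reversed. *)
Definition represents g A := forall x, hval (g x) = hval x *m A.

(** The witnesses are (1, 0, 0, 0) and the points with first coordinate 5/3 and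
    one other coordinate 4/3, from 5^2 = 3^2 + 4^2. *)
Lemma hpoint_frame : exists p q r s : hpoint R, rows4 p q r s \in unitmx.
Proof.
pose v (c d : R) (k : 'I_4) : 'rV[R]_4 := \row_j (if j == 0 then c else if j == k then d else 0).
have vE (c d c' d' : R) k l : k != 0 -> l != 0 ->
    minkowski (v c d k) (v c' d' l) = (if k == l then d * d' else 0) - c * c'.
  rewrite minkowskiE !mxE /=.
  case: k => [[|[|[|[|k]]]] lt_k] // _; case: l => [[|[|[|[|l]]]] lt_l] // _;
    rewrite -!val_eqE /=; ring.
have pr (c d : R) k : k != 0 -> 0 < c -> c ^+ 2 - d ^+ 2 = 1 ->
    (minkowski (v c d k) (v c d k) == -1) && (0 < v c d k 0 0).
  move=> k0 c0 cd; rewrite vE // mxE /= c0 andbT -{}cd eqxx; apply/eqP; ring.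
have p0 : (minkowski (v 1 0 1) (v 1 0 1) == -1) && (0 < v 1 0 1 0 0) by apply: pr => //; lra.
have pk k : k != 0 -> (minkowski (v (5/3) (4/3) k) (v (5/3) (4/3) k) == -1) &&
    (0 < v (5/3) (4/3) k 0 0).
  by move=> k0; apply: pr => //; lra.
have p1 := pk 1 isT; have p2 := pk 2 isT; have p3 := pk 3 isT.
exists (HPoint p0), (HPoint p1), (HPoint p2), (HPoint p3) => /=.
rewrite rows4_unit.
rewrite /gram4 (det_matrix4 (fun i j => minkowski
  [:: v 1 0 1; v (5/3) (4/3) 1; v (5/3) (4/3) 2; v (5/3) (4/3) 3]`_i
  [:: v 1 0 1; v (5/3) (4/3) 1; v (5/3) (4/3) 2; v (5/3) (4/3) 3]`_j)) /=.
by rewrite !vE //= -?val_eqE /= lt_eqF //; lra.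
Qed.

Lemma represents_inj g A B : represents g A -> represents g B -> A = B.
Proof.
have [p [q [r [s X]]]] := hpoint_frame => rA rB.
by apply: (rows4_inj X); rewrite -rA -rB.
Qed.

(** The images of a basis of points have the same Gram matrix, hence form a
    basis; a point is determined by its products with a basis, so g is the
    linear map that sends the first basis to the second. *)
Lemma hisometry_linear g : exists A, represents g A.
Proof.
have [p [q [r [s X]]]] := hpoint_frame.
have Y : rows4 (g p) (g q) (g r) (g s) \in unitmx.
  move: X; rewrite !rows4_unit; congr (is_true (_ != 0)); congr (\det _).
  apply/matrixP => i j; rewrite !mxE.
  by case: i => [[|[|[|[|i]]]] ?] //=; case: j => [[|[|[|[|j]]]] ?] //=;
    rewrite hisometry_minkowski.
have J_unit : J \in unitmx by rewrite unitmxE det_mink_mx unitrN unitr1.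
pose G (M : 'M[R]_4) := J *m M^T.
have GY : G (rows4 (g p) (g q) (g r) (g s)) \in unitmx.
  by rewrite unitmx_mul J_unit unitmx_tr.
exists (G (rows4 p q r s) *m invmx (G (rows4 (g p) (g q) (g r) (g s)))) => x.
rewrite mulmxA; apply: (can_inj (mulmxK GY)); rewrite mulmxKV //.
have rE (v a b c d : 'rV[R]_4) : v *m G (rows4 a b c d) =
    \row_j minkowski v [:: a; b; c; d]`_j.
  apply/rowP => j; rewrite /G mulmxA !mxE minkowski_mx !mxE.
  by apply: eq_bigr => k _; rewrite !mxE.
rewrite !rE; apply/rowP => j; rewrite !mxE.
by case: j => [[|[|[|[|j]]]] ?] //=; rewrite hisometry_minkowski.
Qed.

Lemma represents1 : represents 1%g 1%:M.
Proof. by move=> x; rewrite mulmx1. Qed.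

Lemma representsM g h A B :
  represents g A -> represents h B -> represents (g * h)%g (B *m A).
Proof. by move=> rA rB x; rewrite mulmxA -rB -rA. Qed.

Lemma representsX g A k : represents g A -> represents (g ^+ k)%g (A ^+ k).
Proof.
move=> rA; elim: k => [|k IHk]; first exact: represents1.
by rewrite expgS exprSr; exact: representsM.
Qed.

Definition reflection_mx (e : 'rV[R]_4) : 'M[R]_4 := 1%:M - 2 *: (J *m e^T *m e).

Lemma mul_reflection_mx (x e : 'rV[R]_4) :
  x *m reflection_mx e = x - (2 * minkowski x e) *: e.
Proof.
rewrite /reflection_mx mulmxBr mulmx1 -scalemxAr mulmxA minkowskiM mul_scalar_mx.
by rewrite scalerA.
Qed.

Lemma represents_reflection e g : is_reflection e g -> represents g (reflection_mx e).
Proof. by move=> ge x; rewrite ge mul_reflection_mx. Qed.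

Lemma represents_reflectionV e g : minkowski e e = 1 -> is_reflection e g ->
  represents g^-1%g (reflection_mx e).
Proof.
move=> e1 ge; have gg x : g (g x) = x.
  apply: val_inj; rewrite /= !ge minkowskiDl minkowskiNl minkowskiZl e1.
  by apply/rowP => j; rewrite !mxE; ring.
move=> x; rewrite mul_reflection_mx -ge -[in RHS](hiso_invK g x) gg.
by [].
Qed.

(** For orthonormal c, d: the orthogonal projector onto the plane they span. *)
Definition projector_mx (c d : 'rV[R]_4) : 'M[R]_4 := J *m c^T *m c + J *m d^T *m d.

Lemma mul_projector_mx (x c d : 'rV[R]_4) :
  x *m projector_mx c d = minkowski x c *: c + minkowski x d *: d.
Proof.
rewrite mulmxDr [x *m (J *m c^T *m c)]mulmxA [x *m (J *m d^T *m d)]mulmxA.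
by rewrite !minkowskiM !mul_scalar_mx.
Qed.

Lemma trace_projector_mx (c d c' d' : 'rV[R]_4) :
  \tr (projector_mx c d *m projector_mx c' d') =
  minkowski c c' ^+ 2 + minkowski c d' ^+ 2 + minkowski d c' ^+ 2 + minkowski d d' ^+ 2.
Proof.
have tr2 (x y : 'rV[R]_4) : \tr (J *m x^T *m x *m (J *m y^T *m y)) = minkowski x y ^+ 2.
  rewrite -mulmxA (mulmxA x) minkowskiM mul_scalar_mx -scalemxAr mxtraceZ.
  by rewrite mxtrace_mulC minkowskiM mxtrace_scalar mulr1n minkowskiC expr2.
by rewrite mulmxDl !mulmxDr !mxtraceD !tr2 !addrA.
Qed.

(** The product M of the two reflections fixes c and d, and on the span of a and
    b it is diagonal with eigenvalues l and m = 1/l, where l + m = 4p^2 - 2 > 2.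
    A positive power A of M has eigenvalues L, 1/L, 1, 1 with t = L + 1/L <> 2;
    the polynomial X^2 - t X + 1 kills the first two eigenlines and is 2 - t on
    the others. *)
Lemma translation_power (a b c d : 'rV[R]_4) k : cross_frame a b c d ->
  1 < minkowski a b ^+ 2 ->
  exists2 t, t != 2 &
    let A := (reflection_mx a *m reflection_mx b) ^+ k.+1 in
    \tr A = t + 2 /\ A *m A - t *: A + 1%:M = (2 - t) *: projector_mx c d.
Proof.
move=> fr p1; set p := minkowski a b in p1.
pose r := Num.sqrt (p ^+ 2 - 1).
have r2 : r ^+ 2 = p ^+ 2 - 1 by rewrite sqr_sqrtr // subr_ge0 ltW.
(* With |p| = cosh x, these are exp (2x) and exp (- 2x) in some order. *)
pose l := (p + r) ^+ 2; pose m := (p - r) ^+ 2.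
have lm : l * m = 1.
  have -> : l * m = (p ^+ 2 - r ^+ 2) ^+ 2 by rewrite /l /m; ring.
  by rewrite r2 opprB addrC subrK expr1n.
have ldm : l + m = 4 * p ^+ 2 - 2.
  have -> : l + m = 2 * (p ^+ 2 + r ^+ 2) by rewrite /l /m; ring.
  by rewrite r2; ring.
have l0 : 0 <= l by rewrite sqr_ge0.
have m0 : 0 <= m by rewrite sqr_ge0.
move: l m lm ldm l0 m0 => {r r2} l m lm ldm l0 m0.
pose M := reflection_mx a *m reflection_mx b.
case: (fr) => [[aa bb cc dd] cd [ac ad] [bc bd]].
(* The eigenvector of M for the eigenvalue s, when s is l or m. *)
pose f (s : R) := (- 2 * p) *: a + (1 + s) *: b.
have aM : a *m M = (2 * p) *: b - a.
  rewrite mulmxA !mul_reflection_mx !minkowskiL aa -/p.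
  by apply/rowP => j; rewrite !mxE; ring.
have bM : b *m M = (4 * p ^+ 2 - 1) *: b - (2 * p) *: a.
  rewrite mulmxA !mul_reflection_mx !minkowskiL bb [minkowski b a]minkowskiC -/p.
  by apply/rowP => j; rewrite !mxE; ring.
have fM s s' : s * s' = 1 -> s + s' = 4 * p ^+ 2 - 2 -> f s *m M = s *: f s.
  move=> ss sDs; rewrite mulmxDl -!scalemxAl aM bM.
  apply/rowP => j; rewrite !mxE.
  apply/eqP; rewrite -subr_eq0; apply/eqP.
  transitivity (((4 * p ^+ 2 - 2) * s - s ^+ 2 - 1) * b 0 j); first by ring.
  by rewrite -sDs -ss; ring.
have cM : c *m M = c.
  rewrite mulmxA !mul_reflection_mx [minkowski c a]minkowskiC ac mulr0 scale0r subr0.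
  by rewrite minkowskiC bc mulr0 scale0r subr0.
have dM : d *m M = d.
  rewrite mulmxA !mul_reflection_mx [minkowski d a]minkowskiC ad mulr0 scale0r subr0.
  by rewrite minkowskiC bd mulr0 scale0r subr0.
have powM (v : 'rV[R]_4) s i : v *m M = s *: v -> v *m (M ^+ i) = s ^+ i *: v.
  move=> vM; elim: i => [|i IHi]; first by rewrite expr0 mulmx1 scale1r.
  by rewrite exprSr [LHS]mulmxA IHi -scalemxAl vM scalerA exprSr.
have fc s (x : 'rV[R]_4) : minkowski (f s) x = - 2 * p * minkowski a x + (1 + s) * minkowski b x.
  by rewrite /f !minkowskiL.
have X_unit : rows4 (f l) (f m) c d \in unitmx.
  have ab : minkowski b a = p by rewrite minkowskiC.
  have flf s : s ^+ 2 - (4 * p ^+ 2 - 2) * s + 1 = 0 -> minkowski (f s) (f s) = 0.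
    by move=> E; rewrite fc !minkowskiL aa bb -/p ab -[RHS]E; ring.
  have ll : minkowski (f l) (f l) = 0 by apply: flf; rewrite -ldm -lm; ring.
  have mm : minkowski (f m) (f m) = 0 by apply: flf; rewrite -ldm -lm; ring.
  have lf : minkowski (f l) (f m) = 8 * p ^+ 2 - 8 * p ^+ 4.
    rewrite fc !minkowskiL aa bb -/p ab.
    have -> : - 2 * p * (- 2 * p * 1 + (1 + m) * p) + (1 + l) * (- 2 * p * p + (1 + m) * 1)
      = 4 * p ^+ 2 - 2 * p ^+ 2 * (2 + (l + m)) + (1 + (l + m) + l * m) by ring.
    by rewrite ldm lm; ring.
  have fl_c : minkowski (f l) c = 0 by rewrite fc ac bc; ring.
  have fl_d : minkowski (f l) d = 0 by rewrite fc ad bd; ring.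
  have fm_c : minkowski (f m) c = 0 by rewrite fc ac bc; ring.
  have fm_d : minkowski (f m) d = 0 by rewrite fc ad bd; ring.
  rewrite rows4_unit /gram4 (det_matrix4 (fun i j => minkowski
    [:: f l; f m; c; d]`_i [:: f l; f m; c; d]`_j)) /=.
  rewrite [minkowski (f m) (f l)]minkowskiC ![minkowski c (f _)]minkowskiC.
  rewrite ![minkowski d (f _)]minkowskiC [minkowski d c]minkowskiC.
  rewrite ll mm lf fl_c fl_d fm_c fm_d cc dd cd.
  have -> : 8 * p ^+ 2 - 8 * p ^+ 4 = 8 * p ^+ 2 * (1 - p ^+ 2) by ring.
  have : 8 * p ^+ 2 * (1 - p ^+ 2) != 0 by rewrite lt_eqF //; nra.
  move: (8 * _ * _) => q q0.
  rewrite (_ : _ - _ = - q ^+ 2) ?oppr_eq0 ?sqrf_eq0 //; ring.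
have fL := fM _ _ lm ldm.
have fMm : f m *m M = m *: f m by apply: (fM m l); [rewrite mulrC | rewrite (addrC m)].
set k1 := k.+1.
exists (l ^+ k1 + m ^+ k1).
  have lmk : l ^+ k1 * m ^+ k1 = 1 by rewrite -exprMn lm expr1n.
  apply/eqP => E.
  have : (l ^+ k1 - 1) ^+ 2 = 0.
    have -> : (l ^+ k1 - 1) ^+ 2 = l ^+ k1 * (l ^+ k1 + m ^+ k1 - 2)
      - (l ^+ k1 * m ^+ k1 - 1) by ring.
    by rewrite E lmk !subrr mulr0 subr0.
  move/eqP; rewrite sqrf_eq0 subr_eq0 pexpr_eq1 // => /eqP l1.
  by move: lm ldm; rewrite l1 mul1r => ->; move: p1; lra.
move=> A.
have fA : f l *m A = l ^+ k1 *: f l by exact: powM.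
have gA : f m *m A = m ^+ k1 *: f m by exact: powM.
have cA : c *m A = c by rewrite -[RHS]scale1r -(expr1n _ k1); apply: powM; rewrite scale1r.
have dA : d *m A = d by rewrite -[RHS]scale1r -(expr1n _ k1); apply: powM; rewrite scale1r.
have lmk : l ^+ k1 * m ^+ k1 = 1 by rewrite -exprMn lm expr1n.
move: (l ^+ k1) (m ^+ k1) fA gA lmk => L L' fA gA LL.
split.
  pose D : 'M[R]_4 := diag_mx (\row_i [:: L; L'; 1; 1]`_i).
  have XA : rows4 (f l) (f m) c d *m A = D *m rows4 (f l) (f m) c d.
    apply/row_matrixP => i; rewrite !row_mul row_diag_mx -scalemxAl -rowE !rowK mxE.
    by case: i => [[|[|[|[|i]]]] ?] //=; rewrite ?scale1r.
  have -> : A = invmx (rows4 (f l) (f m) c d) *m (D *m rows4 (f l) (f m) c d).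
    by rewrite -XA mulKmx.
  rewrite mxtrace_mulC -mulmxA mulmxV // mulmx1 mxtrace_diag.
  by rewrite !big_ord_recr big_ord0 /= !mxE /=; ring.
have proj0 s : f s *m projector_mx c d = 0.
  by rewrite mul_projector_mx !fc ac ad bc bd !mulr0 addr0 !scale0r addr0.
have projc : c *m projector_mx c d = c.
  by rewrite mul_projector_mx cc cd scale1r scale0r addr0.
have projd : d *m projector_mx c d = d.
  by rewrite mul_projector_mx dd minkowskiC cd scale1r scale0r add0r.
apply: (rows4_inj X_unit); rewrite mulmxDr mulmxBr mulmx1 -!scalemxAr mulmxA.
- rewrite fA proj0 -scalemxAl fA; move: (f l) => v; apply/rowP => j; rewrite !mxE.
  have -> : L * (L * v 0 j) - (L + L') * (L * v 0 j) + v 0 j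
    = (1 - L * L') * v 0 j by ring.
  by rewrite LL; ring.
- rewrite gA proj0 -scalemxAl gA; move: (f m) => v; apply/rowP => j; rewrite !mxE.
  have -> : L' * (L' * v 0 j) - (L + L') * (L' * v 0 j) + v 0 j
    = (1 - L * L') * v 0 j by ring.
  by rewrite LL; ring.
- by rewrite cA projc cA; apply/rowP => j; rewrite !mxE; ring.
- by rewrite dA projd dA; apply/rowP => j; rewrite !mxE; ring.
Qed.

End Isometries.

(** * The field generated by a Gram matrix *)

Section GramAlgebra.
Variables (R : realType) (F : finType) (e : F -> 'rV[R]_4) (z : R).
Hypothesis gram_z : forall a b, rat_adjoin z (minkowski (e a) (e b)).
Local Notation J := (mink_mx R).
Local Notation K := (rat_adjoin z).

Definition rat_adjoin_mx m n (A : 'M[R]_(m, n)) := forall i j, K (A i j).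

Lemma rat_adjoin_sum (I : finType) (f : I -> R) :
  (forall i, K (f i)) -> K (\sum_i f i).
Proof.
move=> fK; elim/big_ind: _ => //; last exact: rat_adjoinD.
by rewrite -(rmorph0 ratr); exact: rat_adjoin_rat.
Qed.

Lemma rat_adjoin_nat n : K n%:R.
Proof. by rewrite -(ratr_nat R); exact: rat_adjoin_rat. Qed.

Lemma rat_adjoin_mxM m n p (A : 'M[R]_(m, n)) (B : 'M[R]_(n, p)) :
  rat_adjoin_mx A -> rat_adjoin_mx B -> rat_adjoin_mx (A *m B).
Proof.
move=> AK BK i j; rewrite mxE; apply: rat_adjoin_sum => k.
exact: rat_adjoinM.
Qed.

Definition normals : 'M[R]_(#|F|, 4) := \matrix_i e (enum_val i).
Local Notation E := normals.

Lemma gram_rat_adjoin : rat_adjoin_mx (E *m J *m E^T).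
Proof.
move=> i j; have -> : (E *m J *m E^T) i j = minkowski (e (enum_val i)) (e (enum_val j)).
  rewrite minkowski_mx !mxE; apply: eq_bigr => k _; rewrite !mxE.
  by congr (_ * _); apply: eq_bigr => l _; rewrite !mxE.
exact: gram_z.
Qed.

(** The algebra over Q[z] generated by the rank-one matrices x |-> <x, e a> e b.
    It is closed under products because two such matrices multiply to a Gram
    entry times a third one. *)
Definition gram_form (A : 'M[R]_4) := exists c C,
  [/\ K c, rat_adjoin_mx C & A = c%:M + J *m E^T *m C *m E].

Lemma gram_form_scalar c : K c -> gram_form c%:M.
Proof.
move=> cK; exists c, 0; split=> //; last by rewrite mulmx0 mul0mx addr0.
by move=> i j; rewrite mxE; exact: (rat_adjoin_nat 0).
Qed.

Lemma gram_formD A B : gram_form A -> gram_form B -> gram_form (A + B).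
Proof.
move=> [c [C [cK CK ->]]] [d [D [dK DK ->]]]; exists (c + d), (C + D); split.
- exact: rat_adjoinD.
- by move=> i j; rewrite mxE; exact: rat_adjoinD.
by rewrite raddfD /= mulmxDr mulmxDl addrACA.
Qed.

Lemma gram_formM A B : gram_form A -> gram_form B -> gram_form (A *m B).
Proof.
move=> [c [C [cK CK ->]]] [d [D [dK DK ->]]].
exists (c * d), (c *: D + d *: C + C *m (E *m J *m E^T) *m D); split.
- exact: rat_adjoinM.
- move=> i j; rewrite 2!mxE; apply: rat_adjoinD; last first.
    by apply: rat_adjoin_mxM => //; apply: rat_adjoin_mxM => //; exact: gram_rat_adjoin.
  by rewrite !mxE; apply: rat_adjoinD; exact: rat_adjoinM.
rewrite mulmxDl !mulmxDr !mulmxDl -scalar_mxM -!addrA; congr (_ + _).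
rewrite mul_scalar_mx mul_mx_scalar -!scalemxAr -!scalemxAl.
by congr (_ + (_ + _)); rewrite !mulmxA.
Qed.

Lemma gram_formZ k A : K k -> gram_form A -> gram_form (k *: A).
Proof.
by move=> kK AK; rewrite -mul_scalar_mx; apply: gram_formM => //; exact: gram_form_scalar.
Qed.

Lemma gram_form_trace A : gram_form A -> K (\tr A).
Proof.
move=> [c [C [cK CK ->]]]; rewrite mxtraceD mxtrace_scalar -mulr_natr.
apply: rat_adjoinD; first by apply: rat_adjoinM => //; exact: rat_adjoin_nat.
rewrite mxtrace_mulC !mulmxA; apply: rat_adjoin_sum => i.
by apply: rat_adjoin_mxM => //; exact: gram_rat_adjoin.
Qed.

Lemma gram_form_reflection a : gram_form (reflection_mx (e a)).
Proof.
exists 1, (- 2 *: delta_mx (enum_rank a) (enum_rank a)); split.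
- exact: (rat_adjoin_nat 1).
- move=> i j; rewrite !mxE; apply: rat_adjoinM; last exact: rat_adjoin_nat.
  by apply: rat_adjoinN; exact: rat_adjoin_nat.
rewrite /reflection_mx -!scalemxAr -!scalemxAl scaleNr; congr (_ - _ *: _).
rewrite -(mul_delta_mx (0 : 'I_1)) -!mulmxA -rowE rowK enum_rankK; congr (_ *m _).
rewrite mulmxA; congr (_ *m _).
by rewrite -[delta_mx _ _]trmxK trmx_delta -trmx_mul -rowE rowK enum_rankK.
Qed.

Hypothesis norm_e : forall a, minkowski (e a) (e a) = 1.

(** The inverse of g is carried along to obtain a subgroup. *)
Lemma reflection_group_gram_form g : reflection_group e g ->
  exists2 A, represents g A & gram_form A.
Proof.
pose P : set (hisometry R) := [set g | (exists2 A, represents g A & gram_form A) /\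
  (exists2 A, represents g^-1%g A & gram_form A)].
suff sub : reflection_group e `<=` P by move=> /sub[].
apply: smallest_sub; first split.
- split; exists 1%:M; rewrite ?invg1; try exact: represents1.
    by apply: gram_form_scalar; exact: (rat_adjoin_nat 1).
  by apply: gram_form_scalar; exact: (rat_adjoin_nat 1).
- move=> g1 g2 [[A rA gA] [A' rA' gA']] [[B rB gB] [B' rB' gB']]; split.
    by exists (B *m A); [exact: representsM | exact: gram_formM].
  by exists (A' *m B'); rewrite ?invMg; [exact: representsM | exact: gram_formM].
- by move=> g1 [? ?]; split; rewrite ?invgK.
move=> g1 [a ga]; split; exists (reflection_mx (e a)); try exact: gram_form_reflection.
  exact: represents_reflection.
exact: represents_reflectionV.
Qed.

End GramAlgebra.

(** * Commensurable reflection groups *)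

Section Commensurable.
Variable R : realType.

Lemma reflection_group_subgroup (F : finType) (e : F -> 'rV[R]_4) :
  is_subgroup (reflection_group e).
Proof.
split.
- by move=> H [[]].
- by move=> x y Hx Hy H HS; case: (HS) => [[_ HM _] _]; apply: HM; [exact: Hx|exact: Hy].
- by move=> x Hx H HS; case: (HS) => [[_ _ HV] _]; apply: HV; exact: Hx.
Qed.

(** Two powers of x lie in the same left coset. *)
Lemma finite_index_power (G : groupType) (H K : set G) (x : G) :
  is_subgroup H -> K 1%g -> finite_index H K -> H x ->
  exists m, K (x ^+ m.+1)%g.
Proof.
move=> [H1 HM _] K1 fin Hx.
have Hxn i : H (x ^+ i)%g by elim: i => [//|i IHi]; rewrite expgS; exact: HM.
pose f i := left_coset (x ^+ i)%g K.
have [i [j [ij fij]]] : exists i j, (i < j)%N /\ f i = f j.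
  apply: contrapT => nE.
  have finj : injective f.
    move=> i j fij; have [ij|ji|//] := ltngtP i j; exfalso; apply: nE.
      by exists i, j.
    by exists j, i.
  have : finite_set (f @` setT).
    by apply: sub_finite_set fin => _ [i _ <-]; exists (x ^+ i)%g.
  move=> /(finite_preimage (f := f) (in2W finj)).
  by rewrite preimage_range; exact: infinite_nat.
have : f j (x ^+ j)%g by exists 1%g => //; rewrite mulg1.
rewrite -fij => -[k Kk E]; exists (j - i).-1.
rewrite prednK ?subn_gt0 //.
suff -> : (x ^+ (j - i))%g = k by [].
by apply: (mulgI (x ^+ i)%g); rewrite E -expgnDr subnKC // ltnW.
Qed.

(** Here P is the matrix of the conjugating isometry, and P' its inverse. *)
Lemma commensurable_power (F F' : finType) (e : F -> 'rV[R]_4)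
    (e' : F' -> 'rV[R]_4) (z : R) :
  (forall a b, rat_adjoin z (minkowski (e' a) (e' b))) ->
  (forall a, minkowski (e' a) (e' a) = 1) ->
  commensurable (reflection_group e) (reflection_group e') ->
  exists P P' : 'M[R]_4, P *m P' = 1%:M /\
    forall x A, reflection_group e x -> represents x A ->
      exists k B, gram_form e' z B /\ A ^+ k.+1 = P' *m B *m P.
Proof.
move=> gram_z norm_e [g [fin _]].
have [P rP] := hisometry_linear g; have [P' rP'] := hisometry_linear g^-1%g.
exists P, P'; split.
  apply: (represents_inj _ (@represents1 R)).
  by rewrite -(mulVg g); exact: representsM.
move=> x A Hx rA.
have H1 (F0 : finType) (e0 : F0 -> 'rV[R]_4) : reflection_group e0 1%g.
  by case: (reflection_group_subgroup e0).
have [|k [_ [h Hh hE]]] :=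
  finite_index_power (reflection_group_subgroup e) _ fin Hx.
  by split; [exact: H1|exists 1%g; rewrite ?mulg1 ?mulgV //; exact: H1].
have [B rB gB] := reflection_group_gram_form gram_z norm_e Hh.
exists k, B; split=> //.
apply: (represents_inj (representsX k.+1 rA)); rewrite -hE -mulmxA.
by apply: representsM => //; exact: representsM.
Qed.

(** Let u_0, ..., u_4 be consecutive upper faces.  The translations along
    (u_0, u_2) and (u_2, u_4) fix the planes spanned by the top normal and,
    respectively, by u_1 and u_3.  The product of the two projectors has trace
    <t,t>^2 + <u_1,u_3>^2 = 1 + m^2, as t is orthogonal to u_1 and u_3.  Up to
    nonzero factors in Q[z], these projectors are conjugate, by the same matrix,
    to elements of the Gram algebra of the other polyhedron. *)
Lemma commensurable_modulus n (e : lobell_face n -> 'rV[R]_4)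
    (F' : finType) (e' : F' -> 'rV[R]_4) (z : R) :
  (5 <= n)%N -> is_lobell e -> algebraicOver ratr z ->
  (forall a b, rat_adjoin z (minkowski (e' a) (e' b))) ->
  (forall a, minkowski (e' a) (e' a) = 1) ->
  commensurable (reflection_group e) (reflection_group e') ->
  rat_adjoin z (lobell_modulus e ^+ 2).
Proof.
move=> n5 lob [pz pz_neq0 pz0] gram_z norm_e com.
have [P [P' [PP' pow]]] := commensurable_power gram_z norm_e com.
have KM A B : gram_form e' z A -> gram_form e' z B -> gram_form e' z (A *m B).
  exact: (gram_formM gram_z).
pose w j := e (lateral n j).
have Kone := rat_adjoin_nat z 1.
have fr j : cross_frame (w j.*2) (w j.*2.+4) (w j.*2.+2) (e Top).
  have hT i : minkowski (w i.*2) (e Top) = 0.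
    by rewrite minkowskiC; have := cap_orthogonal lob i.*2; rewrite /cap odd_double.
  split; [split | | split | split]; rewrite -?doubleS ?hT //.
  - exact: (lateral_norm lob).
  - exact: (lateral_norm lob).
  - exact: (lateral_norm lob).
  - exact: (normal_unit (lobell_hpolyhedron lob)).
  - by rewrite /w doubleS (lateral_orthogonal2 n5 lob).
  - by rewrite minkowskiC /w doubleS (lateral_orthogonal2 n5 lob).
(* Position 2j is the first of the two faces; position 2j+2, between them, and
   the top span the plane fixed by the translation. *)
have key j : exists t A, [/\ t != 2, rat_adjoin z t, gram_form e' z A &
    (2 - t) *: projector_mx (w j.*2.+2) (e Top) = P' *m A *m P].
  have [r1 g1] := is_reflection_exists (lateral_norm lob j.*2).
  have [r2 g2] := is_reflection_exists (lateral_norm lob j.*2.+4).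
  have Hr : reflection_group e (r2 * r1)%g.
    have [_ HM _] := reflection_group_subgroup e.
    by apply: HM => H [_ HS]; apply: HS; [exists (lateral n j.*2.+4)|exists (lateral n j.*2)].
  have rA := representsM (represents_reflection g2) (represents_reflection g1).
  have [k [B [gB EB]]] := pow _ _ Hr rA.
  have p1 : 1 < minkowski (w j.*2) (w j.*2.+4) ^+ 2.
    by rewrite (lateral_skip4 n5 lob) sqrrN; have := lobell_modulus_gt1 n5 lob; nra.
  have [t t2 [trA quad]] := translation_power k (fr j) p1.
  have trB : \tr (P' *m B *m P) = \tr B.
    by rewrite mxtrace_mulC mulmxA PP' mul1mx.
  have tK : rat_adjoin z t.
    have -> : t = \tr B - 2%:R by rewrite -trB -EB trA addrK.
    apply: rat_adjoinD; first exact: gram_form_trace.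
    by apply: rat_adjoinN; exact: rat_adjoin_nat.
  exists t, (B *m B - t *: B + 1%:M); split=> //.
    apply: gram_formD; first apply: gram_formD.
    - exact: KM.
    - by rewrite -scaleNr; apply: gram_formZ => //; exact: rat_adjoinN.
    - exact: gram_form_scalar.
  rewrite -quad EB mulmxDr mulmxDl mulmxBr mulmxBl mulmx1 (mulmx1C PP').
  congr (_ - _ + _); last by rewrite -scalemxAr -scalemxAl.
  by rewrite !mulmxA -(mulmxA (P' *m B)) PP' mulmx1.
have [t1 [A1 [t1n t1K gA1 E1]]] := key 0.
have [t2 [A2 [t2n t2K gA2 E2]]] := key 2%N.
have E : (2 - t1) * (2 - t2) * (1 + lobell_modulus e ^+ 2) = \tr (A1 *m A2).
  have -> : \tr (A1 *m A2) = \tr ((P' *m A1 *m P) *m (P' *m A2 *m P)).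
    have -> : P' *m A1 *m P *m (P' *m A2 *m P) = P' *m (A1 *m A2) *m P.
      by rewrite !mulmxA -(mulmxA _ P P') PP' mulmx1.
    by rewrite [RHS]mxtrace_mulC (mulmxA P) PP' mul1mx.
  rewrite -E1 -E2 -scalemxAl -scalemxAr !mxtraceZ trace_projector_mx.
  have hT : minkowski (e Top) (e Top) = 1 by exact: (normal_unit (lobell_hpolyhedron lob)).
  have wT i : minkowski (w i.*2.+2) (e Top) = 0.
    by rewrite minkowskiC; have := cap_orthogonal lob i.*2.+2; rewrite /cap /= negbK odd_double.
  rewrite [minkowski (w 0.*2.+2) (w _)](lateral_skip4 n5 lob 2) hT wT.
  by rewrite [minkowski (e Top) _]minkowskiC wT; ring.
have nz : (2 - t1) * (2 - t2) != 0 by rewrite mulf_neq0 // subr_eq0 eq_sym.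
have -> : lobell_modulus e ^+ 2 = \tr (A1 *m A2) * ((2 - t1) * (2 - t2))^-1 - 1%:R.
  by rewrite -E mulrC mulKf // addrC addKr.
have tK t : rat_adjoin z t -> rat_adjoin z (2 - t).
  by move=> ?; apply: rat_adjoinD; [exact: rat_adjoin_nat|exact: rat_adjoinN].
apply: rat_adjoinD; last by apply: rat_adjoinN.
apply: rat_adjoinM; first by apply: (gram_form_trace gram_z); exact: KM.
by apply: (rat_adjoinV pz_neq0 pz0); apply: rat_adjoinM; exact: tK.
Qed.

End Commensurable.

Theorem mainTheorem6 (R : realType)
    (L : forall n : nat, lobell_face n -> 'rV[R]_4)
    (hL : forall n : nat, (5 <= n)%N -> is_lobell (L n)) :
  ~ exists k : nat -> nat,
      [/\ (5 <= k 0)%N,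
          forall i j : nat, (i < j)%N -> (k i < k j)%N &
          forall i j : nat, i <> j ->
            commensurable (reflection_group (L (k i)))
                          (reflection_group (L (k j)))].
Proof.
case=> k [k0 k_incr com].
have le_k i : (i <= k i)%N by elim: i => // i /leq_ltn_trans; apply; exact: k_incr.
have k5 i : (5 <= k i)%N.
  by case: i => // i; apply: (leq_trans k0); apply: ltnW; exact: k_incr.
have lob i := hL (k i) (k5 i).
pose gram (p : lobell_face (k 0%N) * lobell_face (k 0%N)) :=
  minkowski (L (k 0%N) p.1) (L (k 0%N) p.2).
have [x|z z_alg z_gen] := @algebraic_primitive_element R [seq gram p | p : _].
  by case/mapP=> p _ ->; exact: (lobell_gram_algebraic (k5 0%N) (lob 0%N)).
have gram_z a b : rat_adjoin z (minkowski (L (k 0%N) a) (L (k 0%N) b)).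
  by apply: z_gen; apply/mapP; exists (a, b); rewrite ?mem_enum.
have [p p_neq0 pz] := z_alg.
pose N := (4 * (size p).-1).*2`!.
pose i := N.+1.
have mK : rat_adjoin z (lobell_modulus (L (k i)) ^+ 2).
  apply: (commensurable_modulus (k5 i) (lob i) z_alg gram_z) => [a|].
    exact: (normal_unit (lobell_hpolyhedron (lob 0%N))).
  by apply: com.
have [g [g_neq0 g_size g_root]] := rat_adjoin_degree p_neq0 pz mK.
have ki0 : (0 < k i)%N by apply: leq_trans (k5 i).
have [c0 c1] := lobell_cheb (k5 i) (lob i).
have : (totient (k i) <= 4 * (size g).-1)%N.
  have := @totient_le_cheb_degree R (lobell_modulus (L (k i)) - 1) (k i).-1 g.
  rewrite prednK // subrK; apply=> //.
  exact: (lobell_cheb_order (k5 i) (lob i)).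
move=> tot; have := leq_trans (le_k i) (leq_fact_totient ki0).
apply/negP; rewrite -ltnNge ltnS; apply: leq_fact.
by rewrite leq_double (leq_trans tot) // leq_mul2l -!subn1 leq_sub2r.
Qed.
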